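(* Let $n\ge 3$, $A=(a_1,\dots,a_n)$ positive integers, $\Pi=\prod_{i=1}^n\{0,\dots,a_i\}$, and let $T$ be a tiling. Let $\mathbb{F}$ be an ordered field and $\{x_I\}_{I\in\mathrm{vert}(T)}$ positive elements of $\mathbb{F}$. Then there is a unique way of extending $\{x_I\}$ to a labeling $\{x_I\}_{I\in\Pi}$ of all of $\Pi$ by elements of $\mathbb{F}$ such that all equations $$x_{I+e_j+e_\ell}\,x_{I+e_k}=x_I\,x_{I+e_j+e_k+e_\ell}+x_{I+e_j+e_k}\,x_{I+e_\ell}+x_{I+e_k+e_\ell}\,x_{I+e_j}\qquad(1\le j<k<\ell\le n)$$ are satisfied (for all $I$ such that all eight indices lie in $\Pi$).
   Context: Let $C=\prod_{i=1}^n[0,a_i]$ be the cubical complex with vertex set $\Pi$. Fix $0<\theta_1<\dots<\theta_n<\pi$, $v_i=(\cos\theta_i,\sin\theta_i)$, $\pi:C\to\mathbb{R}^2$, $\pi(x)=\sum x_iv_i$, $P=\pi(C)$. A tiling is a two-dimensional subcomplex $T\subset C$ such that $\pi|_T:T\to P$ is a homeomorphism; $\mathrm{vert}(T)$ is its set of vertices. *)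

(* Defs.v *)
From HB Require Import structures.
From mathcomp Require Import all_boot all_order all_algebra.
From mathcomp Require Import all_classical all_reals all_analysis.

Set Implicit Arguments.
Unset Strict Implicit.
Unset Printing Implicit Defensive.

Import Order.TTheory GRing.Theory Num.Theory.
Import numFieldNormedType.Exports.

Local Open Scope classical_set_scope.
Local Open Scope ring_scope.

Definition mindex (n : nat) := {ffun 'I_n -> nat}.

Definition Pi (n : nat) (a : 'I_n -> nat) : set (mindex n) :=
  [set I | forall i, (I i <= a i)%N].

(* I + \sum_(i in S) e_i *)
Definition shift_by (n : nat) (I : mindex n) (S : {set 'I_n}) : mindex n :=
  [ffun i => (I i + (i \in S))%N].

(* The pair (I, S) stands for the closed unit cube of dimension #|S| whose
   least vertex is I and whose edge directions are the e_i, i \in S. *)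
Definition cell (n : nat) := (mindex n * {set 'I_n})%type.

Definition cell_dim (n : nat) (c : cell n) : nat := #|c.2|.

Definition box_cells (n : nat) (a : 'I_n -> nat) : set (cell n) :=
  [set c : cell n |
    forall S : {set 'I_n}, S \subset c.2 -> Pi a (shift_by c.1 S)].

(* The faces of (I, S) are the (I + e_U, S') with U and S' disjoint subsets
   of S. *)
Definition is_face (n : nat) (d c : cell n) : Prop :=
  exists U : {set 'I_n},
    [/\ U \subset c.2, d.2 \subset c.2 :\: U & d.1 = shift_by c.1 U].

Definition subcomplex (n : nat) (a : 'I_n -> nat) (T : set (cell n)) : Prop :=
  T `<=` box_cells a /\ (forall c d, T c -> is_face d c -> T d).

Definition two_dimensional (n : nat) (T : set (cell n)) : Prop :=
  (forall c, T c -> (cell_dim c <= 2)%N) /\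
  (exists2 c, T c & cell_dim c = 2%N).

Definition vert (n : nat) (T : set (cell n)) : set (mindex n) :=
  [set I | T (I, finset.set0)].

Definition box (R : realType) (n : nat) (a : 'I_n -> nat) : set 'rV[R]_n :=
  [set x | forall i, 0 <= x ord0 i <= (a i)%:R].
Arguments box R {n} a.

Definition cell_body (R : realType) (n : nat) (c : cell n) : set 'rV[R]_n :=
  [set x | forall i, (c.1 i)%:R <= x ord0 i <= (shift_by c.1 c.2 i)%:R].
Arguments cell_body R {n} c.

Definition body (R : realType) (n : nat) (T : set (cell n)) : set 'rV[R]_n :=
  \bigcup_(c in T) cell_body R c.
Arguments body R {n} T.

Definition direction (R : realType) (t : R) : (R^o * R^o)%type :=
  (cos t, sin t).

Definition plane_proj (R : realType) (n : nat) (theta : 'I_n -> R)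
    (x : 'rV[R]_n) : (R^o * R^o)%type :=
  \sum_(i < n) x ord0 i *: direction (theta i).

Definition zonotope (R : realType) (n : nat) (a : 'I_n -> nat)
    (theta : 'I_n -> R) : set (R^o * R^o)%type :=
  plane_proj theta @` box R a.

(* A and B carry the topologies induced by X and Y. *)
Definition homeomorphism_on (X Y : topologicalType) (A : set X) (B : set Y)
    (f : X -> Y) : Prop :=
  exists g : Y -> X,
    [/\ (forall x, A x -> B (f x) /\ g (f x) = x),
        (forall y, B y -> A (g y) /\ f (g y) = y),
        {within A, continuous f} & {within B, continuous g}].

Definition is_tiling (R : realType) (n : nat) (a : 'I_n -> nat)
    (theta : 'I_n -> R) (T : set (cell n)) : Prop :=
  [/\ subcomplex a T, two_dimensional T &
      homeomorphism_on (body R T) (zonotope a theta) (plane_proj theta)].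

(* A labeling of a subset of the index lattice is a total function on the
   lattice, of which only the values on that subset matter. *)
Definition cube_recurrence (F : realFieldType) (n : nat) (a : 'I_n -> nat)
    (x : mindex n -> F) : Prop :=
  forall (I : mindex n) (j k l : 'I_n), (j < k)%N -> (k < l)%N ->
    (forall S : {set 'I_n}, S \subset [set j; k; l]%SET ->
      Pi a (shift_by I S)) ->
    x (shift_by I [set j; l]%SET) * x (shift_by I [set k]%SET) =
      x I * x (shift_by I [set j; k; l]%SET)
      + x (shift_by I [set j; k]%SET) * x (shift_by I [set l]%SET)
      + x (shift_by I [set k; l]%SET) * x (shift_by I [set j]%SET).

Definition is_extension (F : realFieldType) (n : nat) (a : 'I_n -> nat)
    (T : set (cell n)) (x y : mindex n -> F) : Prop :=
  (forall I, vert T I -> y I = x I) /\ cube_recurrence a y.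

(* Main.v *)
Require Import Defs.
From mathcomp Require Import all_boot all_order all_algebra.
From mathcomp Require Import all_classical all_reals all_analysis.
From mathcomp Require Import zify ring lra.

(* Encode a monotone lattice path from 0 to (a_1, ..., a_n) by its word of
   directions.  Sweeping such a path across the tiling, from the right boundary
   of the zonotope to the left one, turns the tiling into a maximal chain of
   swaps i j -> j i (i < j) of adjacent letters; the vertices of the tiling are
   the vertices on the paths of the chain.  As for reduced words of the longest
   permutation, any two such chains are connected by commutations and braid
   moves i j k -> k j i.  Commutations do not change the vertex set and a braid
   move trades I + e_j for I + e_i + e_k, whose labels determine each other by
   one cube equation without ever dividing by zero, because all labels met are
   positive.  It is therefore enough to extend labels from one vertex set: that
   of the indices I with I_k = a_k whenever j < k < l and I_j, I_l > 0.  There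
   the other labels are computed recursively from the cubes spanned by the
   extreme directions of the support, and all other cube equations follow from
   the consistency of the recurrence on four-dimensional cubes. *)

Set Implicit Arguments.
Unset Strict Implicit.
Unset Printing Implicit Defensive.

Import Order.TTheory GRing.Theory Num.Theory.
Import numFieldNormedType.Exports.

Local Open Scope classical_set_scope.
Local Open Scope ring_scope.

(* [lia] does not use that the summands [nat_of_bool _] of a simplified
   [count_mem] are nonnegative. *)
Ltac count_lia :=
  rewrite /= ?eqxx; change (nat_of_bool true) with 1%N;
  repeat match goal with
  | |- context [nat_of_bool ?b] => generalize (nat_of_bool b); intro
  end; lia.

(** Uniqueness rests on the same moves: every index of [Pi a] lies on some chain that starts at the
    increasing word, and agreement of two solutions passes from one chain to another. Only labels of
    the positive solution are cancelled there, so the competing solution may take any values. Of the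
    homeomorphism, injectivity keeps tiles from overlapping, surjectivity puts the right boundary
    edges into the tiling, and continuity of the inverse provides a tile to the left of every edge
    that is not on the left boundary. The obstacle in the recursion is that the cube computing the
    label of [I] contains the larger index [I + e_k]; filling all coordinates strictly between the
    extremes of the support gives a size that this step leaves unchanged, while the remaining
    corners of the cube lower it. *)

Definition add_seq (n : nat) (I : mindex n) (s : seq 'I_n) : mindex n :=
  [ffun i => (I i + count_mem i s)%N].

Lemma add_seqE n (I : mindex n) (s : seq 'I_n) (i : 'I_n) :
  add_seq I s i = (I i + count_mem i s)%N.
Proof. exact: ffunE. Qed.

Lemma add_seqA n (I : mindex n) s t :
  add_seq (add_seq I s) t = add_seq I (s ++ t).
Proof. by apply/ffunP => i; rewrite !add_seqE count_cat addnA. Qed.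

Lemma eq_add_seq n (I : mindex n) s t :
  (forall i, count_mem i s = count_mem i t) -> add_seq I s = add_seq I t.
Proof. by move=> st; apply/ffunP => i; rewrite !add_seqE st. Qed.

Lemma add_seq0 n (I : mindex n) : add_seq I [::] = I.
Proof. by apply/ffunP => i; rewrite add_seqE addn0. Qed.

Lemma shift_by_seq n (I : mindex n) (S : {set 'I_n}) s :
  uniq s -> S =i s -> shift_by I S = add_seq I s.
Proof.
by move=> us Ss; apply/ffunP => i; rewrite !ffunE Ss count_uniq_mem.
Qed.

(** Lists replace sets of directions so that successive shifts concatenate and equality of indices
    reduces to equality of letter counts. *)
Definition cube_eq (F : realFieldType) (n : nat) (x : mindex n -> F)
    (J : mindex n) (j k l : 'I_n) : Prop :=
  x (add_seq J [:: j; l]) * x (add_seq J [:: k]) =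
    x J * x (add_seq J [:: j; k; l])
    + x (add_seq J [:: j; k]) * x (add_seq J [:: l])
    + x (add_seq J [:: k; l]) * x (add_seq J [:: j]).

Lemma Pi_le n (a : 'I_n -> nat) (I I' : mindex n) :
  (forall i, (I i <= I' i)%N) -> Pi a I' -> Pi a I.
Proof. by move=> le h i; apply: leq_trans (h i). Qed.

(** [Pi a] is closed downwards, so the condition on all eight indices reduces to the top one. *)
Lemma cube_recurrenceP (F : realFieldType) n (a : 'I_n -> nat)
    (x : mindex n -> F) :
  cube_recurrence a x <->
  forall J (j k l : 'I_n), (j < k)%N -> (k < l)%N ->
    Pi a (add_seq J [:: j; k; l]) -> cube_eq x J j k l.
Proof.
have E (J : mindex n) (j k l : 'I_n) : (j < k)%N -> (k < l)%N ->
  [/\ shift_by J [set j; l]%SET = add_seq J [:: j; l],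
      shift_by J [set j; k; l]%SET = add_seq J [:: j; k; l],
      shift_by J [set j; k]%SET = add_seq J [:: j; k] &
      shift_by J [set k; l]%SET = add_seq J [:: k; l] ] /\
      forall i, shift_by J [set i]%SET = add_seq J [:: i].
  move=> jk kl; have jl := ltn_trans jk kl.
  have njk : j != k by apply: contraTneq jk => ->; rewrite ltnn.
  have nkl : k != l by apply: contraTneq kl => ->; rewrite ltnn.
  have njl : j != l by apply: contraTneq jl => ->; rewrite ltnn.
  split; first split.
  - by apply: shift_by_seq => [|i] /=; rewrite !inE ?njl.
  - by apply: shift_by_seq => [|i] /=; rewrite !inE ?negb_or ?njl ?njk ?nkl -?orbA.
  - by apply: shift_by_seq => [|i] /=; rewrite !inE ?njk.
  - by apply: shift_by_seq => [|i] /=; rewrite !inE ?nkl.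
  - by move=> i0; apply: shift_by_seq => [|i] /=; rewrite ?inE.
split=> H J j k l jk kl hP; have [[E1 E2 E3 E4] E5] := E J j k l jk kl.
- have := H J j k l jk kl; rewrite E1 E2 E3 E4 !E5; apply => S sub.
  apply: Pi_le hP => i; rewrite -E2 !ffunE leq_add2l.
  by case: (boolP (i \in S)) => // /(fintype.subsetP sub) ->.
- rewrite E1 E2 E3 E4 !E5; apply: H => //.
  by rewrite -E2; apply: hP.
Qed.

(** * Consistency on a four-dimensional cube *)

(** Digits name the directions added to the base. Four of the eight facets determine [x13], [x24],
    [x124], [x134] after division by [x2], [x3], [x23]. Two further facets give formulas for the one
    remaining unknown [x14], and these coincide; the last two facets then become rational
    identities. *)
Lemma four_cube_alg (F : realFieldType)
  (x0 x1 x2 x3 x4 x12 x13 x14 x23 x24 x34 x123 x124 x134 x234 x1234 : F) :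
  x2 != 0 -> x3 != 0 -> x23 != 0 ->
  x13 * x2 = x0 * x123 + x12 * x3 + x23 * x1 ->
  x24 * x3 = x0 * x234 + x23 * x4 + x34 * x2 ->
  x124 * x23 = x2 * x1234 + x123 * x24 + x234 * x12 ->
  x134 * x23 = x3 * x1234 + x123 * x34 + x234 * x13 ->
  (x14 * x2 = x0 * x124 + x12 * x4 + x24 * x1 <->
   x14 * x3 = x0 * x134 + x13 * x4 + x34 * x1) /\
  (x14 * x2 = x0 * x124 + x12 * x4 + x24 * x1 ->
   x134 * x24 = x4 * x1234 + x124 * x34 + x234 * x14 /\
   x124 * x13 = x1 * x1234 + x123 * x14 + x134 * x12).
Proof.
move=> n2 n3 n23 e13 e24 e124 e134.
have {}e13 : x13 = (x0 * x123 + x12 * x3 + x23 * x1) / x2 by rewrite -e13 mulfK.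
have {}e24 : x24 = (x0 * x234 + x23 * x4 + x34 * x2) / x3 by rewrite -e24 mulfK.
have {}e124 : x124 = (x2 * x1234 + x123 * x24 + x234 * x12) / x23 by rewrite -e124 mulfK.
have {}e134 : x134 = (x3 * x1234 + x123 * x34 + x234 * x13) / x23 by rewrite -e134 mulfK.
have key : (x0 * x124 + x12 * x4 + x24 * x1) / x2 = (x0 * x134 + x13 * x4 + x34 * x1) / x3.
  by rewrite e124 e134 e13 e24; field; rewrite n2 n3 n23.
split.
  split=> e.
  - have -> : x14 = (x0 * x124 + x12 * x4 + x24 * x1) / x2 by rewrite -e mulfK.
    by rewrite key mulfVK.
  - have -> : x14 = (x0 * x134 + x13 * x4 + x34 * x1) / x3 by rewrite -e mulfK.
    by rewrite -key mulfVK.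
move=> e; have -> : x14 = (x0 * x124 + x12 * x4 + x24 * x1) / x2 by rewrite -e mulfK.
by split; rewrite e124 e134 e13 e24; field; rewrite n2 n3 n23.
Qed.

Lemma four_cube (F : realFieldType) n (x : mindex n -> F) J (p q r s : 'I_n) :
  (forall t, subseq t [:: p; q; r; s] -> x (add_seq J t) != 0) ->
  cube_eq x J p q r -> cube_eq x J q r s ->
  cube_eq x (add_seq J [:: q]) p r s -> cube_eq x (add_seq J [:: r]) p q s ->
  (cube_eq x J p q s <-> cube_eq x J p r s) /\
  (cube_eq x J p q s ->
   cube_eq x (add_seq J [:: s]) p q r /\ cube_eq x (add_seq J [:: p]) q r s).
Proof.
move=> nz; rewrite /cube_eq !add_seqA /=.
have [E1 [E2 [E3 [E4 E5]]]] : add_seq J [:: q; p] = add_seq J [:: p; q] /\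
  add_seq J [:: r; p] = add_seq J [:: p; r] /\
  add_seq J [:: r; q] = add_seq J [:: q; r] /\
  add_seq J [:: s; p] = add_seq J [:: p; s] /\
  add_seq J [:: s; q] = add_seq J [:: q; s].
  by do !split; apply: eq_add_seq => i /=; lia.
have [E6 [E7 [E8 [E9 [Ea Eb]]]]] : add_seq J [:: q; p; s] = add_seq J [:: p; q; s] /\
  add_seq J [:: q; p; r] = add_seq J [:: p; q; r] /\
  add_seq J [:: r; p; s] = add_seq J [:: p; r; s] /\
  add_seq J [:: r; q; s] = add_seq J [:: q; r; s] /\
  add_seq J [:: r; p; q] = add_seq J [:: p; q; r] /\
  add_seq J [:: s; p; r] = add_seq J [:: p; r; s].
  by do !split; apply: eq_add_seq => i /=; lia.
have [Ec [Ed [Ee [Ef [Eg Eh]]]]] : add_seq J [:: s; p; q] = add_seq J [:: p; q; s] /\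
  add_seq J [:: s; q; r] = add_seq J [:: q; r; s] /\
  add_seq J [:: s; r] = add_seq J [:: r; s] /\
  add_seq J [:: q; p; r; s] = add_seq J [:: p; q; r; s] /\
  add_seq J [:: r; p; q; s] = add_seq J [:: p; q; r; s] /\
  add_seq J [:: s; p; q; r] = add_seq J [:: p; q; r; s].
  by do !split; apply: eq_add_seq => i /=; lia.
rewrite E1 E2 E3 E4 E5 E6 E7 E8 E9 Ea Eb Ec Ed Ee Ef Eg Eh.
by apply: four_cube_alg; apply: nz; rewrite /= ?eqxx //; do ?case: ifP; rewrite ?eqxx.
Qed.

(** * Hulls and the recursion *)

Section Hull.
Variables (n : nat) (a : 'I_n -> nat).
Implicit Types (I J : mindex n) (i j k l : 'I_n) (s : seq 'I_n).

Definition inner I i :=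
  [exists j : 'I_n, (j < i)%N && (0 < I j)%N] &&
  [exists l : 'I_n, (i < l)%N && (0 < I l)%N].

(** Induction measure: insensitive to adding a letter strictly inside the range of the support, and
    strictly smaller once a coordinate that is not inner drops. *)
Definition hull I : nat := \sum_i (if inner I i then a i else I i).

Definition weight I : nat := \sum_i I i.

Lemma innerP I j k l :
  (j < k)%N -> (k < l)%N -> (0 < I j)%N -> (0 < I l)%N -> inner I k.
Proof.
by move=> jk kl Ij Il; apply/andP; split; apply/existsP;
  [exists j | exists l]; apply/andP.
Qed.

Lemma inner_le I I' i : (forall i, (I i <= I' i)%N) -> inner I i -> inner I' i.
Proof.
move=> le /andP[/existsP[j /andP[ji Ij]] /existsP[l /andP[il Il]]].
by apply: innerP ji il _ _; [apply: leq_trans Ij _ | apply: leq_trans Il _].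
Qed.

Lemma weight_add I s : weight (add_seq I s) = (weight I + size s)%N.
Proof.
rewrite /weight; under eq_bigr do rewrite add_seqE.
rewrite big_split /=; congr (_ + _)%N.
elim: s => [|i s IHs] /=; first by rewrite big1.
by rewrite big_split /= IHs (bigD1 i) //= eqxx big1 // => k /negbTE; rewrite eq_sym => ->.
Qed.

Lemma hull_le I I' :
  Pi a I' -> (forall i, (I i <= I' i)%N) -> (hull I <= hull I')%N.
Proof.
move=> PI le; apply: leq_sum => i _.
case: ifP => [/(inner_le le) ->//|_]; case: ifP => _ //.
exact: leq_trans (le i) (PI i).
Qed.

Lemma hull_lt I I' m :
  Pi a I' -> (forall i, (I i <= I' i)%N) -> (I m < I' m)%N ->
  ~~ inner I' m -> (hull I < hull I')%N.
Proof.
move=> PI le lt nin; rewrite /hull (bigD1 m) //= [X in (_ < X)%N](bigD1 m) //=.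
have nin' : ~~ inner I m by apply: contra nin; apply: inner_le.
rewrite (negbTE nin) (negbTE nin') -addSn leq_add //.
apply: leq_sum => i _.
case: ifP => [/(inner_le le) ->//|_]; case: ifP => _ //.
exact: leq_trans (le i) (PI i).
Qed.

(** Wherever the new letter [k] witnesses that a coordinate is inner, one of the two support
    elements around [k] does so already. *)
Lemma hull_add_inner I k : inner I k -> hull (add_seq I [:: k]) = hull I.
Proof.
move=> ik; apply: eq_bigr => i _; rewrite !add_seqE /= addn0.
have le j : (I j <= add_seq I [:: k] j)%N by rewrite add_seqE leq_addr.
have -> : inner (add_seq I [:: k]) i = inner I i.
  apply/idP/idP; last exact: inner_le.
  have /andP[/existsP[j0 /andP[jk Ij]] /existsP[l0 /andP[kl Il]]] := ik.
  move=> /andP[/existsP[j /andP[ji]]]; rewrite add_seqE /= addn0 => Hj.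
  move=> /existsP[l /andP[il]]; rewrite add_seqE /= addn0 => Hl.
  apply/andP; split; apply/existsP.
  - case: (eqVneq k j) Hj => [e _|_]; last by rewrite addn0 => Hj; exists j; rewrite ji.
    by exists j0; rewrite Ij (ltn_trans jk) // e.
  - case: (eqVneq k l) Hl => [e _|_]; last by rewrite addn0 => Hl; exists l; rewrite il.
    by exists l0; rewrite Il andbT (ltn_trans _ kl) // e.
by case: ifP => // ni; case: eqVneq => [e|_]; [rewrite -e ik in ni | rewrite addn0].
Qed.

Lemma weight_le_hull I : Pi a I -> (weight I <= hull I)%N.
Proof. by move=> PI; apply: leq_sum => i _; case: ifP. Qed.

Definition is_min I j := (0 < I j)%N && [forall i : 'I_n, (i < j)%N ==> (I i == 0%N)].
Definition is_max I l := (0 < I l)%N && [forall i : 'I_n, (l < i)%N ==> (I i == 0%N)].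

Lemma is_minP I j : is_min I j -> (0 < I j)%N /\ forall i, (i < j)%N -> I i = 0%N.
Proof. by move=> /andP[-> /forallP h]; split=> // i ij; apply/eqP/(implyP (h i)). Qed.

Lemma is_maxP I j : is_max I j -> (0 < I j)%N /\ forall i, (j < i)%N -> I i = 0%N.
Proof. by move=> /andP[-> /forallP h]; split=> // i ij; apply/eqP/(implyP (h i)). Qed.

Lemma is_min_ex I j : (0 < I j)%N -> exists2 m : 'I_n, (m <= j)%N & is_min I m.
Proof.
move=> Ij; case: (arg_minnP (fun i : 'I_n => i : nat) (P := fun i => (0 < I i)%N) Ij) => m Im mP.
exists m; first exact: mP.
rewrite /is_min Im; apply/forallP => i; apply/implyP => im; rewrite -leqn0 leqNgt.
by apply/negP => /mP; rewrite leqNgt im.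
Qed.

Lemma is_max_ex I j : (0 < I j)%N -> exists2 m : 'I_n, (j <= m)%N & is_max I m.
Proof.
move=> Ij; case: (arg_maxnP (fun i : 'I_n => i : nat) (P := fun i => (0 < I i)%N) Ij) => m Im mP.
exists m; first exact: mP.
rewrite /is_max Im; apply/forallP => i; apply/implyP => im; rewrite -leqn0 leqNgt.
by apply/negP => /mP /=; rewrite leqNgt im.
Qed.

Lemma is_min_not_inner I j : is_min I j -> ~~ inner I j.
Proof.
move=> /is_minP[_ h]; apply/negP => /andP[/existsP[i /andP[ij]]].
by rewrite h.
Qed.

Lemma is_max_not_inner I j : is_max I j -> ~~ inner I j.
Proof.
move=> /is_maxP[_ h]; apply/negP => /andP[_ /existsP[i /andP[ij]]].
by rewrite h.
Qed.

Lemma is_min_uniq I j j' : is_min I j -> is_min I j' -> j = j'.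
Proof.
move=> /is_minP[p h] /is_minP[p' h']; apply/val_inj => /=.
by case: (ltngtP j j') => // [/h' e|/h e]; [rewrite e in p | rewrite e in p'].
Qed.

Lemma is_max_uniq I j j' : is_max I j -> is_max I j' -> j = j'.
Proof.
move=> /is_maxP[p h] /is_maxP[p' h']; apply/val_inj => /=.
by case: (ltngtP j j') => // [/h e|/h' e]; [rewrite e in p' | rewrite e in p].
Qed.

Lemma is_min_le I I' j :
  (forall i, (I i <= I' i)%N) -> (0 < I j)%N -> is_min I' j -> is_min I j.
Proof.
move=> le Ij /is_minP[_ h]; rewrite /is_min Ij.
by apply/forallP => i; apply/implyP => /h e; rewrite -leqn0 -e.
Qed.

Lemma is_max_le I I' j :
  (forall i, (I i <= I' i)%N) -> (0 < I j)%N -> is_max I' j -> is_max I j.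
Proof.
move=> le Ij /is_maxP[_ h]; rewrite /is_max Ij.
by apply/forallP => i; apply/implyP => /h e; rewrite -leqn0 -e.
Qed.

Lemma is_min_add I j s :
  is_min I j -> all (fun i : 'I_n => j <= i)%N s -> is_min (add_seq I s) j.
Proof.
move=> /is_minP[Ij h] /allP hs; rewrite /is_min add_seqE addn_gt0 Ij.
apply/forallP => i; apply/implyP => ij; rewrite add_seqE h // add0n.
by apply/eqP/count_memPn/negP => /hs; rewrite leqNgt ij.
Qed.

Lemma is_max_add I j s :
  is_max I j -> all (fun i : 'I_n => i <= j)%N s -> is_max (add_seq I s) j.
Proof.
move=> /is_maxP[Ij h] /allP hs; rewrite /is_max add_seqE addn_gt0 Ij.
apply/forallP => i; apply/implyP => ij; rewrite add_seqE h // add0n.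
by apply/eqP/count_memPn/negP => /hs; rewrite leqNgt ij.
Qed.

(* The recursion below computes the value at [I] from the cube whose directions
   [j] and [l] are the extreme elements of the support of [I]. *)
Definition corner I (t : 'I_n * 'I_n * 'I_n) :=
  [&& (t.1.1 < t.1.2)%N, (t.1.2 < t.2)%N, is_min I t.1.1, is_max I t.2 &
      (I t.1.2 < a t.1.2)%N].

Definition interval_pt I :=
  forall j k l, (j < k)%N -> (k < l)%N -> (0 < I j)%N -> (0 < I l)%N ->
    (a k <= I k)%N.

Lemma interval_no_corner I : interval_pt I -> forall t, corner I t = false.
Proof.
move=> h [[j k] l]; apply/negP => /and5P[/= jk kl /is_minP[Ij _] /is_maxP[Il _] Ik].
by move: Ik; rewrite ltnNge (h j k l).
Qed.

Definition sub_seq I (s : seq 'I_n) : mindex n := [ffun i => (I i - count_mem i s)%N].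

Lemma sub_seqK I s : (forall i : 'I_n, (count_mem i s <= I i)%N) -> add_seq (sub_seq I s) s = I.
Proof. by move=> h; apply/ffunP => i; rewrite add_seqE ffunE subnK. Qed.

Lemma sub_seq1K I i : (0 < I i)%N -> add_seq (sub_seq I [:: i]) [:: i] = I.
Proof. by move=> Ii; apply: sub_seqK => k /=; rewrite addn0; case: eqVneq => [<-|]. Qed.

(** In the cube computing the label of [I], the top has the same hull and one more unit of weight;
    the other corners have smaller hull and lose at most two units of weight. The factor 3 outweighs
    this loss. The subtraction is not truncated on [Pi a], where the weight is at most the hull. *)
Definition mu I := (3 * hull I - weight I)%N.

Definition cube_rest j k l : seq (seq 'I_n) :=
  [:: [::]; [:: j; k; l]; [:: j; k]; [:: l]; [:: k; l]; [:: j]; [:: k]].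

Section Corner.
Variables (J : mindex n) (j k l : 'I_n).
Hypotheses (jk : (j < k)%N) (kl : (k < l)%N) (PJ : Pi a (add_seq J [:: j; k; l])).
Let I := add_seq J [:: j; l].

Lemma cube_top_fill : hull (add_seq J [:: j; k; l]) = hull I.
Proof.
have -> : add_seq J [:: j; k; l] = add_seq I [:: k].
  by rewrite add_seqA; apply: eq_add_seq => i; count_lia.
by apply/hull_add_inner/(innerP jk kl); rewrite add_seqE /= eqxx; lia.
Qed.

(** The letter [j] is still the least of the support at the top of the cube, hence not inner there,
    so omitting it costs hull. *)
Lemma cube_top_min s :
  (forall i : 'I_n, (count_mem i s <= count_mem i [:: k; l])%N) -> is_min I j ->
  (hull (add_seq J s) < hull I)%N.
Proof.
move=> h mn; rewrite -cube_top_fill; apply: (@hull_lt _ _ j) => //.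
- by move=> i; rewrite !add_seqE leq_add2l; apply: leq_trans (h i) _; count_lia.
- by rewrite !add_seqE ltn_add2l; apply: leq_ltn_trans (h j) _; count_lia.
- apply: is_min_not_inner.
  have -> : add_seq J [:: j; k; l] = add_seq I [:: k].
    by rewrite add_seqA; apply: eq_add_seq => i; count_lia.
  by apply: is_min_add => //=; rewrite ltnW.
Qed.

Lemma cube_top_max s :
  (forall i : 'I_n, (count_mem i s <= count_mem i [:: j; k])%N) -> is_max I l ->
  (hull (add_seq J s) < hull I)%N.
Proof.
move=> h mn; rewrite -cube_top_fill; apply: (@hull_lt _ _ l) => //.
- by move=> i; rewrite !add_seqE leq_add2l; apply: leq_trans (h i) _; count_lia.
- by rewrite !add_seqE ltn_add2l; apply: leq_ltn_trans (h l) _; count_lia.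
- apply: is_max_not_inner.
  have -> : add_seq J [:: j; k; l] = add_seq I [:: k].
    by rewrite add_seqA; apply: eq_add_seq => i; count_lia.
  by apply: is_max_add => //=; rewrite ltnW.
Qed.

Lemma cube_rest_Pi s : s \in cube_rest j k l -> Pi a (add_seq J s).
Proof.
move=> hs; apply: Pi_le PJ => i; rewrite !add_seqE leq_add2l.
by move: hs; rewrite !inE; do ?case/orP; move=> /eqP ->; count_lia.
Qed.

Lemma corner_mu s : is_min I j -> is_max I l -> s \in cube_rest j k l ->
  (mu (add_seq J s) < mu I)%N.
Proof.
move=> mn mx hs; rewrite /mu !weight_add /=.
have Pt := cube_rest_Pi hs.
have := weight_le_hull Pt; rewrite weight_add.
have PI : Pi a I.
  by apply: Pi_le PJ => i; rewrite !add_seqE leq_add2l; count_lia.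
have := weight_le_hull PI; rewrite weight_add /=.
have [/eqP ->/=|ne] := boolP (s == [:: j; k; l]); first by rewrite cube_top_fill; lia.
have : (hull (add_seq J s) < hull I)%N.
  move: hs ne; rewrite !inE; do ?case/orP; move=> /eqP ->; rewrite ?eqxx // => _;
  by [apply: cube_top_min => // i; count_lia | apply: cube_top_max => // i; count_lia].
have : (size s <= 2)%N.
  by move: hs ne; rewrite !inE; do ?case/orP; move=> /eqP ->; rewrite ?eqxx.
lia.
Qed.

End Corner.
End Hull.

(** * Positive solutions from labels on the interval points *)

Section IntervalExtension.
Variables (F : realFieldType) (n : nat) (a : 'I_n -> nat) (x : mindex n -> F).
Implicit Types (I J : mindex n) (i j k l : 'I_n) (s : seq 'I_n).

Lemma no_corner_interval I :
  (forall t, corner a I t = false) -> interval_pt a I.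
Proof.
move=> h j k l jk kl Ij Il; rewrite leqNgt; apply/negP => Ik.
have [j' jj' mj] := is_min_ex Ij; have [l' ll' ml] := is_max_ex Il.
have := h (j', k, l'); rewrite /corner /= mj ml Ik.
by rewrite (leq_ltn_trans jj' jk) (leq_trans kl ll').
Qed.

Definition cube_top (e : seq 'I_n -> F) j k l : F :=
  (e [::] * e [:: j; k; l] + e [:: j; k] * e [:: l] + e [:: k; l] * e [:: j])
  / e [:: k].

Lemma eq_cube_top e e' j k l :
  (forall s, s \in cube_rest j k l -> e s = e' s) ->
  cube_top e j k l = cube_top e' j k l.
Proof. by move=> h; rewrite /cube_top !h // !inE eqxx ?orbT. Qed.

(** Fuel stands in for well-founded recursion on [mu]. At zero fuel [x I] is a dummy value, not
    reached from an index of [Pi a] when the initial fuel exceeds [mu]. *)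
Fixpoint ext (m : nat) (I : mindex n) : F :=
  if m is m'.+1 then
    if [pick t | corner a I t] is Some (j, k, l) then
      cube_top (fun s => ext m' (add_seq (sub_seq I [:: j; l]) s)) j k l
    else x I
  else x I.

Lemma corner_cube I j k l (J := sub_seq I [:: j; l]) :
  Pi a I -> corner a I (j, k, l) ->
  [/\ (j < k)%N, (k < l)%N, is_min I j, is_max I l & I = add_seq J [:: j; l]] /\
  Pi a (add_seq J [:: j; k; l]).
Proof.
move=> PI /and5P[/= jk kl mj ml Ik].
have [Ij _] := is_minP mj; have [Il _] := is_maxP ml.
have IJ : I = add_seq J [:: j; l].
  rewrite sub_seqK // => i /=; rewrite addn0.
  case: (eqVneq j i) => [<-|_]; last by case: eqVneq => [<-|].
  case: eqVneq => [e|_]; last by [].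
  by move: (ltn_trans jk kl); rewrite e ltnn.
split=> // i.
have -> : add_seq J [:: j; k; l] = add_seq I [:: k].
  by rewrite IJ add_seqA; apply: eq_add_seq => i'; count_lia.
rewrite add_seqE /= addn0; case: eqVneq => [<-|_]; first by rewrite addn1.
by rewrite addn0.
Qed.

Lemma corner_rest I j k l s (J := sub_seq I [:: j; l]) :
  Pi a I -> corner a I (j, k, l) -> s \in cube_rest j k l ->
  Pi a (add_seq J s) /\ (mu a (add_seq J s) < mu a I)%N.
Proof.
move=> PI c hs; have [[jk kl mj ml IJ] PJ] := corner_cube PI c.
split; first exact: cube_rest_Pi hs.
by rewrite {1}IJ; apply: corner_mu hs => //; rewrite -IJ.
Qed.

Lemma ext_fuel m m' I :
  Pi a I -> (mu a I < m)%N -> (mu a I < m')%N -> ext m I = ext m' I.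
Proof.
elim: m m' I => // m IHm [|m'] I // PI hm hm' /=.
case: pickP => // -[[j k] l] c.
apply: eq_cube_top => s /(corner_rest PI c)[Ps hs]; apply: IHm => //.
- exact: leq_trans hs hm.
- exact: leq_trans hs hm'.
Qed.

Definition extension I := ext (mu a I).+1 I.

Lemma extension_interval I : interval_pt a I -> extension I = x I.
Proof.
move=> /interval_no_corner h; rewrite /extension /=.
by case: pickP => // t; rewrite h.
Qed.

Lemma extension_corner I j k l : Pi a I ->
  [pick t | corner a I t] = Some (j, k, l) ->
  extension I = cube_top (fun s => extension (add_seq (sub_seq I [:: j; l]) s)) j k l.
Proof.
move=> PI e; rewrite {1}/extension /= e.
have c : corner a I (j, k, l) by move: e; case: pickP => // t ct [<-].
by apply: eq_cube_top => s /(corner_rest PI c)[Ps hs]; apply: ext_fuel.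
Qed.

Hypothesis x_gt0 : forall I, interval_pt a I -> 0 < x I.

Lemma extension_gt0 I : Pi a I -> 0 < extension I.
Proof.
have [m] := ubnP (mu a I); elim: m I => // m IHm I; rewrite ltnS => hm PI.
case e : [pick t | corner a I t] => [[[j k] l]|]; last first.
  have h t : corner a I t = false by move: e; case: pickP.
  by rewrite extension_interval; [apply: x_gt0|]; apply: no_corner_interval.
have c : corner a I (j, k, l) by move: e; case: pickP => // t ct [<-].
have pos s : s \in cube_rest j k l ->
    0 < extension (add_seq (sub_seq I [:: j; l]) s).
  by move=> /(corner_rest PI c)[Ps hs]; apply: IHm => //; apply: leq_trans hs hm.
rewrite (extension_corner PI e) /cube_top.
by rewrite divr_gt0 ?addr_gt0 ?mulr_gt0 ?pos // !inE eqxx ?orbT.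
Qed.

(** The direction [k0] is the one that [pick] chose when the label of [I] was defined, so its
    equation holds by construction; the given [k] only shows that some corner exists. *)
Lemma extension_corner_eq J j k l (I := add_seq J [:: j; l]) :
  (j < k)%N -> (k < l)%N -> Pi a (add_seq J [:: j; k; l]) ->
  is_min I j -> is_max I l ->
  exists k0 : 'I_n, [/\ (j < k0)%N, (k0 < l)%N,
    Pi a (add_seq J [:: j; k0; l]) & cube_eq extension J j k0 l].
Proof.
move=> jk kl PJ mj ml.
have PI : Pi a I by apply: Pi_le PJ => i; rewrite !add_seqE leq_add2l; count_lia.
have Ik : (I k < a k)%N.
  apply: leq_trans (PJ k); rewrite !add_seqE; count_lia.
case e : [pick t | corner a I t] => [[[j' k0] l']|]; last first.
  move: e; case: pickP => // /(_ (j, k, l)).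
  by rewrite /corner /= jk kl mj ml Ik.
have c : corner a I (j', k0, l') by move: e; case: pickP => // t ct [<-].
have [[jk0 k0l mj' ml' IJ] PJ'] := corner_cube PI c.
have ej := is_min_uniq mj mj'; have el := is_max_uniq ml ml'; subst j' l'.
have EJ : sub_seq I [:: j; l] = J.
  by apply/ffunP => i; rewrite ffunE /I add_seqE addnK.
rewrite EJ in PJ'; exists k0; split=> //; rewrite /cube_eq.
have := extension_corner PI e; rewrite EJ => ->.
rewrite /cube_top mulfVK ?add_seq0 //.
apply/lt0r_neq0/extension_gt0; apply: Pi_le PJ' => i.
by rewrite !add_seqE leq_add2l; count_lia.
Qed.

Lemma four_cube_extension J (p q r s : 'I_n) :
  Pi a (add_seq J [:: p; q; r; s]) ->
  cube_eq extension J p q r -> cube_eq extension J q r s ->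
  cube_eq extension (add_seq J [:: q]) p r s ->
  cube_eq extension (add_seq J [:: r]) p q s ->
  (cube_eq extension J p q s <-> cube_eq extension J p r s) /\
  (cube_eq extension J p q s ->
   cube_eq extension (add_seq J [:: s]) p q r /\
   cube_eq extension (add_seq J [:: p]) q r s).
Proof.
move=> PJ; apply: four_cube => t ht; apply/lt0r_neq0/extension_gt0.
by apply: Pi_le PJ => i; rewrite !add_seqE leq_add2l leq_count_subseq.
Qed.

(* Strong induction on the hull of the vertex [J + e_j + e_l] that the
   recurrence is solved for.  If [j] and [l] are the extreme elements of its
   support, the equation for one [k] is the definition of the extension, and
   the four-cube with directions [j], [k], [k'], [l] gives it for the others.
   Otherwise the four-cube containing also an extreme direction applies. *)
Lemma extension_cube J j k l : (j < k)%N -> (k < l)%N ->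
  Pi a (add_seq J [:: j; k; l]) -> cube_eq extension J j k l.
Proof.
have [h] := ubnP (hull a (add_seq J [:: j; l])).
elim: h J j k l => // h IHh.
have Psub J s s' : (forall i : 'I_n, (count_mem i s <= count_mem i s')%N) ->
    Pi a (add_seq J s') -> Pi a (add_seq J s).
  by move=> le; apply: Pi_le => i; rewrite !add_seqE leq_add2l.
have Hsub J s s' : (forall i : 'I_n, (count_mem i s <= count_mem i s')%N) ->
    Pi a (add_seq J s') -> (hull a (add_seq J s) <= hull a (add_seq J s'))%N.
  by move=> le P'; apply: hull_le => // i; rewrite !add_seqE leq_add2l.
have extreme J j k l : (hull a (add_seq J [:: j; l]) <= h)%N ->
    (j < k)%N -> (k < l)%N -> Pi a (add_seq J [:: j; k; l]) ->
    is_min (add_seq J [:: j; l]) j -> is_max (add_seq J [:: j; l]) l ->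
    cube_eq extension J j k l.
  (* Inner induction on the room above [J]: the facets based at [J + e_k1] and [J + e_k2] keep both
     extreme directions and do not raise the hull, so only the weight of the base makes progress.
     The other two facets needed lack [l] or [j] and have smaller hull. *)
  have [g] := ubnP (\sum_i a i - weight J)%N.
  elim: g J j k l => // g IHg J j k l hg hh jk kl PJ mj ml.
  have tJ (i0 : 'I_n) : Pi a (add_seq J [:: i0]) ->
      (\sum_i a i - weight (add_seq J [:: i0]) < g)%N.
    move=> P0; have : (weight (add_seq J [:: i0]) <= \sum_i a i)%N by apply: leq_sum => i _.
    by move: hg; rewrite weight_add /=; lia.
  have step k1 k2 : (j < k1)%N -> (k1 < k2)%N -> (k2 < l)%N ->
      Pi a (add_seq J [:: j; k1; k2; l]) ->
      cube_eq extension J j k1 l <-> cube_eq extension J j k2 l.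
    move=> jk1 k12 k2l P4; have k1l := ltn_trans k12 k2l; have jk2 := ltn_trans jk1 k12.
    have P1 : Pi a (add_seq J [:: j; k1; l]) by apply: Psub P4 => i; count_lia.
    have P2 : Pi a (add_seq J [:: j; k2; l]) by apply: Psub P4 => i; count_lia.
    apply: (proj1 (four_cube_extension P4 _ _ _ _)).
    - apply: IHh => //; last by apply: Psub P4 => i; count_lia.
      apply: leq_trans hh; apply: (cube_top_max (k := k2)) => //; lia.
    - apply: IHh => //; last by apply: Psub P4 => i; count_lia.
      apply: leq_trans hh; apply: (cube_top_min (k := k1)) => //; lia.
    - have E : add_seq (add_seq J [:: k1]) [:: j; l] = add_seq (add_seq J [:: j; l]) [:: k1].
        by rewrite !add_seqA; apply: eq_add_seq => i; count_lia.
      apply: IHg => //; first (apply: tJ; apply: Psub P4 => i; count_lia); rewrite ?E.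
      + apply: leq_trans hh; rewrite add_seqA.
        rewrite -(cube_top_fill a J jk1 k1l).
        by apply: Hsub => [i|//]; count_lia.
      + by rewrite add_seqA; apply: Psub P4 => i; count_lia.
      + by apply: is_min_add => //=; lia.
      + by apply: is_max_add => //=; lia.
    - have E : add_seq (add_seq J [:: k2]) [:: j; l] = add_seq (add_seq J [:: j; l]) [:: k2].
        by rewrite !add_seqA; apply: eq_add_seq => i; count_lia.
      apply: IHg => //; first (apply: tJ; apply: Psub P4 => i; count_lia); rewrite ?E.
      + apply: leq_trans hh; rewrite add_seqA.
        rewrite -(cube_top_fill a J jk2 k2l).
        by apply: Hsub => [i|//]; count_lia.
      + by rewrite add_seqA; apply: Psub P4 => i; count_lia.
      + by apply: is_min_add => //=; lia.
      + by apply: is_max_add => //=; lia.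
  have [k0 [jk0 k0l P0 e0]] := extension_corner_eq jk kl PJ mj ml.
  have P4 : k != k0 -> Pi a (add_seq J [:: j; k; k0; l]).
    move=> ne i; have := PJ i; have := P0 i; rewrite !add_seqE /=.
    case: (eqVneq k i) => [e|_]; case: (eqVneq k0 i) => [e1|_]; try count_lia.
    by rewrite e e1 eqxx in ne.
  case: (ltngtP k k0) => kk0.
  - apply/(step k k0) => //; apply: P4.
    by apply: contraTneq kk0 => ->; rewrite ltnn.
  - apply/(step k0 k) => //.
    have /P4 : k != k0 by apply: contraTneq kk0 => ->; rewrite ltnn.
    by apply: Psub => i; count_lia.
  - by have -> : k = k0 by apply/val_inj.
have minimal J j k l : (hull a (add_seq J [:: j; l]) <= h)%N ->
    (j < k)%N -> (k < l)%N -> Pi a (add_seq J [:: j; k; l]) ->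
    is_min (add_seq J [:: j; l]) j -> cube_eq extension J j k l.
  move=> hh jk kl PJ mj.
  have [] := @is_max_ex _ (add_seq J [:: j; l]) l; first by rewrite add_seqE; count_lia.
  move=> s; rewrite leq_eqVlt => /predU1P[/val_inj <-|ls ms]; first exact: extreme.
  have Js : (0 < J s)%N.
    have [+ _] := is_maxP ms; rewrite add_seqE /= addn0.
    by do !case: eqVneq => [e|_]; subst; rewrite ?addn0 //; lia.
  (* The wanted cube is the facet at [J' + e_s] of the four-cube with directions [j], [k], [l], [s].
     Facets using both [j] and [s] fall under [extreme]; the two others, based at [J'], have smaller
     hull. *)
  pose J' := sub_seq J [:: s].
  have EJ : J = add_seq J' [:: s] by rewrite sub_seq1K.
  have P4 : Pi a (add_seq J' [:: j; k; l; s]).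
    by move: PJ; rewrite EJ add_seqA; apply: Psub => i; count_lia.
  have hI : add_seq J [:: j; l] = add_seq J' [:: j; l; s].
    by rewrite EJ add_seqA; apply: eq_add_seq => i; count_lia.
  rewrite hI in hh mj ms; rewrite EJ.
  have jl := ltn_trans jk kl; have js := ltn_trans jl ls; have ks := ltn_trans kl ls.
  have P1 k1 : k1 \in [:: k; l] -> Pi a (add_seq J' [:: j; k1; s]).
    by rewrite !inE => /orP[] /eqP ->; apply: Psub P4 => i; count_lia.
  have btw k1 : k1 \in [:: k; l] -> (j < k1)%N /\ (k1 < s)%N.
    by rewrite !inE => /orP[] /eqP ->.
  have le0 i : (add_seq J' [:: j; s] i <= add_seq J' [:: j; l; s] i)%N.
    by rewrite !add_seqE leq_add2l; count_lia.
  have mj0 : is_min (add_seq J' [:: j; s]) j.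
    by apply: is_min_le le0 _ mj; rewrite add_seqE; count_lia.
  have ms0 : is_max (add_seq J' [:: j; s]) s.
    by apply: is_max_le le0 _ ms; rewrite add_seqE; count_lia.
  have hh0 : (hull a (add_seq J' [:: j; s]) <= h)%N.
    by rewrite -(cube_top_fill a J' jl ls).
  have ex1 k1 k2 : k1 \in [:: k; l] -> k2 \in [:: k; l] -> k1 != k2 ->
      cube_eq extension (add_seq J' [:: k1]) j k2 s.
    move=> h1 h2 ne; have [jk1 k1s] := btw _ h1; have [jk2 k2s] := btw _ h2.
    have E : add_seq (add_seq J' [:: k1]) [:: j; s] =
             add_seq (add_seq J' [:: j; s]) [:: k1].
      by rewrite !add_seqA; apply: eq_add_seq => i; count_lia.
    apply: extreme => //; rewrite ?E.
    - rewrite hull_add_inner //.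
      by apply: (innerP jk1 k1s); rewrite add_seqE; count_lia.
    - rewrite add_seqA; apply: Psub P4 => i.
      by move: h1 h2 ne; rewrite !inE => /orP[] /eqP -> /orP[] /eqP ->;
         rewrite ?eqxx // => _; count_lia.
    - by apply: is_min_add => //=; rewrite ltnW.
    - by apply: is_max_add => //=; rewrite ltnW.
  have nkl : k != l by apply: contraTneq kl => ->; rewrite ltnn.
  apply: (proj1 (proj2 (four_cube_extension P4 _ _ _ _) _)).
  - apply: IHh => //; last by apply: Psub P4 => i; count_lia.
    apply: leq_trans hh0; apply: (cube_top_max (k := l)) => //.
      by apply: P1; rewrite !inE eqxx orbT.
  - apply: IHh => //; last by apply: Psub P4 => i; count_lia.
    apply: leq_trans hh0; apply: (cube_top_min (k := k)) => //.
      by apply: P1; rewrite !inE eqxx.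
  - by apply: ex1; rewrite ?inE ?eqxx ?orbT.
  - by apply: ex1; rewrite ?inE ?eqxx ?orbT // eq_sym.
  - by apply: extreme => //; apply: P1; rewrite !inE eqxx.
move=> J j k l; rewrite ltnS => hh jk kl PJ.
have [] := @is_min_ex _ (add_seq J [:: j; l]) j; first by rewrite add_seqE; count_lia.
move=> m; rewrite leq_eqVlt => /predU1P[/val_inj ->|mj mm]; first exact: minimal.
have jl := ltn_trans jk kl.
have Jm : (0 < J m)%N.
  have [+ _] := is_minP mm; rewrite add_seqE /= addn0.
  by do !case: eqVneq => [e|_]; subst; rewrite ?addn0 //; lia.
(* Now the wanted cube is the facet at [J' + e_m]. Facets that use direction [m] fall under
   [minimal], and the parallel facet at [J'] has lost a unit at the non-inner coordinate [m], so its
   hull is smaller. *)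
pose J' := sub_seq J [:: m].
have EJ : J = add_seq J' [:: m] by rewrite sub_seq1K.
have Efull : add_seq J' [:: m; j; k; l] = add_seq (add_seq J [:: j; l]) [:: k].
  by rewrite EJ !add_seqA; apply: eq_add_seq => i; count_lia.
have P4 : Pi a (add_seq J' [:: m; j; k; l]).
  by rewrite Efull add_seqA; apply: Psub PJ => i; count_lia.
have mfull : is_min (add_seq J' [:: m; j; k; l]) m.
  by rewrite Efull; apply: is_min_add => //=; lia.
have hfull : (hull a (add_seq J' [:: m; j; k; l]) <= h)%N.
  rewrite Efull hull_add_inner //.
  by apply: (innerP jk kl); rewrite add_seqE; count_lia.
have mini t (i2 i3 : 'I_n) : (m < i2)%N -> (i2 < i3)%N ->
    (forall i : 'I_n,
      (count_mem i (t ++ [:: m; i2; i3]) <= count_mem i [:: m; j; k; l])%N) ->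
    cube_eq extension (add_seq J' t) m i2 i3.
  move=> mi2 i23 ct; have ct' i : (count_mem i (t ++ [:: m; i3]) <= count_mem i [:: m; j; k; l])%N.
    by apply: leq_trans (ct i); rewrite !count_cat leq_add2l; count_lia.
  apply: minimal => //; rewrite add_seqA.
  - by apply: leq_trans hfull; apply: Hsub.
  - exact: Psub P4.
  - apply: is_min_le mfull => [i|]; first by rewrite !add_seqE leq_add2l.
    by rewrite add_seqE count_cat; count_lia.
rewrite EJ; apply: (proj2 (proj2 (four_cube_extension P4 _ _ _ _) _)).
- by rewrite -[J']add_seq0; apply: mini => // i; count_lia.
- apply: IHh => //; last by apply: Psub P4 => i; count_lia.
  apply: leq_trans hfull; apply: (@hull_lt _ _ _ _ m) => //.
  + by move=> i; rewrite !add_seqE leq_add2l; count_lia.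
  + rewrite !add_seqE ltn_add2l.
    have -> : count_mem m [:: j; l] = 0%N.
      apply/count_memPn; rewrite !inE negb_or; apply/andP.
      by split; [apply: contraTneq mj | apply: contraTneq (ltn_trans mj jl)] => ->; rewrite ltnn.
    by count_lia.
  + exact: is_min_not_inner.
- by apply: mini; [lia | | move=> i; count_lia].
- by apply: mini => [//||i]; [lia | count_lia].
- by rewrite -[J']add_seq0; apply: mini => // i; count_lia.
Qed.
End IntervalExtension.

Lemma interval_extension (F : realFieldType) n (a : 'I_n -> nat) (x : mindex n -> F) :
  (forall I, interval_pt a I -> 0 < x I) ->
  exists y : mindex n -> F, [/\ forall I, Pi a I -> 0 < y I, cube_recurrence a y &
    forall I, interval_pt a I -> y I = x I].
Proof.
move=> x0; exists (extension a x); split.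
- exact: extension_gt0.
- by apply/cube_recurrenceP => J j k l jk kl PJ; apply: extension_cube.
- exact: extension_interval.
Qed.

(** * Words and chains of swaps *)

Section Words.
Variables (n : nat) (a : 'I_n -> nat).
Implicit Types (I : mindex n) (i j k : 'I_n) (u v w : seq 'I_n) (S W : set (mindex n)).

Definition vtx (u : seq 'I_n) : mindex n := add_seq [ffun=> 0%N] u.

Lemma vtxE u i : vtx u i = count_mem i u.
Proof. by rewrite /vtx add_seqE ffunE. Qed.

Lemma eq_vtx u v : (forall i : 'I_n, count_mem i u = count_mem i v) -> vtx u = vtx v.
Proof. exact: eq_add_seq. Qed.

Lemma weight_vtx u : weight (vtx u) = size u.
Proof. by rewrite weight_add /weight big1 // => i _; rewrite ffunE. Qed.

Definition slope (I : mindex n) : nat := (\sum_(i < n) i * I i)%N.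

Lemma slope_add I u : slope (add_seq I u) = (slope I + sumn (map val u))%N.
Proof.
rewrite /slope; under eq_bigr do rewrite add_seqE mulnDr.
rewrite big_split /=; congr (_ + _)%N.
elim: u => [|i u IHu] /=; first by rewrite big1 // => i _; rewrite muln0.
under eq_bigr do rewrite mulnDr; rewrite big_split /= IHu; congr (_ + _)%N.
rewrite (bigD1 i) //= eqxx muln1 big1 ?addn0 // => k.
by rewrite eq_sym => /negbTE ->; rewrite muln0.
Qed.

Lemma slope_vtx u : slope (vtx u) = sumn (map val u).
Proof. by rewrite slope_add /slope big1 // => i _; rewrite ffunE muln0. Qed.

Definition path_vert w : set (mindex n) :=
  [set I | exists u v, w = u ++ v /\ I = vtx u].

Inductive up : seq 'I_n -> seq 'I_n -> Prop :=
  Up u i j v of (i < j)%N : up (u ++ i :: j :: v) (u ++ j :: i :: v).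

Lemma upP w w' : up w w' -> exists u i j v,
  [/\ (i < j)%N, w = u ++ i :: j :: v & w' = u ++ j :: i :: v].
Proof. by case=> u i j v ij; exists u, i, j, v. Qed.

Lemma path_vert_cat u v : path_vert (u ++ v) (vtx u).
Proof. by exists u, v. Qed.

Lemma cat_prefix (T : eqType) (u v u' v' : seq T) :
  (size u <= size u')%N -> u ++ v = u' ++ v' ->
  exists m, u' = u ++ m /\ v = m ++ v'.
Proof.
move=> le e; exists (drop (size u) u').
have := congr1 (take (size u)) e; rewrite take_size_cat // takel_cat // => eu.
have := congr1 (drop (size u)) e; rewrite drop_size_cat // drop_cat.
split; first by rewrite {1}eu cat_take_drop.
move: e; rewrite -{1}(cat_take_drop (size u) u') -eu -catA => /eqP.
by rewrite eqseq_cat // eqxx => /eqP.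
Qed.

(** A swap of adjacent letters alters only the prefix that ends between them. *)
Lemma path_vert_swap u i j v :
  path_vert (u ++ j :: i :: v) `<=`
  path_vert (u ++ i :: j :: v) `|` [set vtx (u ++ [:: j])].
Proof.
move=> I [p [s [e ->]]].
have [le|lt] := leqP (size p) (size u).
  have [m [-> _]] := cat_prefix le (esym e).
  by left; exists p, (m ++ i :: j :: v); rewrite -catA.
have [[|x [|y m]] [ep em]] := cat_prefix (ltnW lt) e.
- by rewrite ep cats0 ltnn in lt.
- by right; case: em ep => <- _ ->.
- case: em ep => <- <- ev ->; left.
  have -> : vtx (u ++ [:: j, i & m]) = vtx (u ++ [:: i, j & m]).
    by apply: eq_vtx => k; rewrite !count_cat; count_lia.
  by exists (u ++ [:: i, j & m]), s; rewrite ev -catA.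
Qed.

Lemma up_count w w' i : up w w' -> count_mem i w = count_mem i w'.
Proof. by case=> u j k v _; rewrite !count_cat; count_lia. Qed.

(** Termination measure for climbs: the pairs of letters in increasing order, one of which
    disappears at each [up]. Its counterpart [desc] serves to go back to the increasing word. *)
Fixpoint asc w : nat :=
  if w is i :: w' then (count (fun j : 'I_n => i < j)%N w' + asc w')%N else 0%N.

Fixpoint desc w : nat :=
  if w is i :: w' then (count (fun j : 'I_n => j < i)%N w' + desc w')%N else 0%N.

Lemma asc_up w w' : up w w' -> (asc w' < asc w)%N.
Proof.
case=> u i j v ij; elim: u => [|k u IHu] /=; last first.
  by rewrite -addnS leq_add // !count_cat /=; lia.
have -> : (j < i)%N = false by lia.
by rewrite ij; lia.
Qed.

Lemma desc_up w w' : up w w' -> (desc w < desc w')%N.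
Proof.
case=> u i j v ij; elim: u => [|k u IHu] /=; last first.
  by rewrite -addnS leq_add // !count_cat /=; lia.
have -> : (j < i)%N = false by lia.
by rewrite ij; lia.
Qed.

(* [climb w S]: [S] is the set of vertices on the paths of some maximal chain
   of swaps starting from [w]. *)
Inductive climb : seq 'I_n -> set (mindex n) -> Prop :=
| climb_end w : (forall w', ~ up w w') -> climb w (path_vert w)
| climb_step w w' S : up w w' -> climb w' S -> climb w (path_vert w `|` S).

Lemma climbP w S : climb w S ->
  (S = path_vert w /\ forall w', ~ up w w') \/
  (exists w' S', [/\ up w w', climb w' S' & S = path_vert w `|` S']).
Proof.
by case=> {w S} [w nup|w w' S ww' cS]; [left | right; exists w', S].
Qed.

Lemma climb_path w S : climb w S -> path_vert w `<=` S.
Proof. by case=> {w S} [w _ //|w w' S _ _ I wI]; left. Qed.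

(** The invariant has to survive only one suitable step out of each word, not every step; the chain
    is built from those. *)
Lemma climb_build (Q : seq 'I_n -> Prop) :
  (forall w, Q w -> (exists w', up w w') -> exists2 w', up w w' & Q w') ->
  forall w, Q w ->
  exists2 S, climb w S & forall I, S I -> exists2 w', Q w' & path_vert w' I.
Proof.
move=> Qup w; have [m] := ubnP (asc w); elim: m w => // m IHm w hm Qw.
have [ex|nex] := pselect (exists w', up w w').
  have [w' ww' Qw'] := Qup w Qw ex.
  have [|S cS hS] := IHm w' _ Qw'; first by move: (asc_up ww') hm; lia.
  exists (path_vert w `|` S); first exact: climb_step ww' cS.
  by move=> I [wI|/hS//]; exists w.
exists (path_vert w); last by move=> I wI; exists w.
by apply: climb_end => w' ww'; apply: nex; exists w'.
Qed.

Lemma climb_ex w : exists S, climb w S.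
Proof.
by have [//|//|S cS _] := @climb_build (fun=> True) _ w; [move=> ? _ [w' ?]; exists w'|exists S].
Qed.

(* At each level of [weight] the slope of the vertex of a path grows along a
   climb; this keeps the vertices before and after a braid move apart. *)
Definition below W w := forall I, W I ->
  forall u v, w = u ++ v -> size u = weight I -> (slope I <= slope (vtx u))%N.

Definition above S w := forall I, S I ->
  forall u v, w = u ++ v -> size u = weight I -> (slope (vtx u) <= slope I)%N.

Lemma path_level w I u v :
  path_vert w I -> w = u ++ v -> size u = weight I -> I = vtx u.
Proof.
move=> [u' [v' [-> ->]]] e; rewrite weight_vtx => s.
have [m [eu _]] := cat_prefix (eq_leq (esym s)) e.
have sm : size m = 0%N by apply/eqP; rewrite -(eqn_add2l (size u')) -size_cat -eu s addn0.
by rewrite eu (size0nil sm) cats0.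
Qed.

Lemma below_path w : below (path_vert w) w.
Proof. by move=> I wI u v e s; rewrite (path_level wI e s). Qed.

Lemma above_path w : above (path_vert w) w.
Proof. by move=> I wI u v e s; rewrite (path_level wI e s). Qed.

Lemma slope_up w w' u v u' v' : up w w' -> w = u ++ v -> w' = u' ++ v' ->
  size u = size u' -> (slope (vtx u) <= slope (vtx u'))%N.
Proof.
case=> p i j s ij e e' su; rewrite !slope_vtx.
have [le|lt] := leqP (size u) (size p).
  have [m [ep _]] := cat_prefix le (esym e).
  rewrite su in le; have [m' [ep' _]] := cat_prefix le (esym e').
  by move: ep'; rewrite ep => /eqP; rewrite eqseq_cat // => /andP[/eqP -> _].
have lt' : (size p < size u')%N by rewrite -su.
have [m [eu em]] := cat_prefix (ltnW lt) e.
have [m' [eu' em']] := cat_prefix (ltnW lt') e'.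
have sm : size m = size m' by apply/eqP; rewrite -(eqn_add2l (size p)) -!size_cat -eu -eu' su.
rewrite eu eu' !map_cat !sumn_cat leq_add2l.
move: em em' sm lt; rewrite eu size_cat.
case: m {eu} => [|x [|y m]]; case: m' {eu'} => [|x' [|y' m']] //=; rewrite ?addn0 ?ltnn //.
  by move=> [<- _] [<- _] _ _; rewrite ?addn0 ltnW.
move=> [<- <- e1] [<- <- e2] [sm] _.
have : m ++ v = m' ++ v' by rewrite -e1.
by move=> /eqP; rewrite eqseq_cat // => /andP[/eqP -> _]; lia.
Qed.

Lemma up_size w w' : up w w' -> size w = size w'.
Proof. by case=> u i j v _; rewrite !size_cat. Qed.

Lemma below_up W w w' : up w w' -> below W w -> below (W `|` path_vert w) w'.
Proof.
move=> ww' bW I WI u v e s.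
have sw : (size u <= size w)%N by rewrite (up_size ww') e size_cat leq_addr.
have bI : below (W `|` path_vert w) w.
  by move=> I' [/bW//|/below_path].
apply: leq_trans (slope_up ww' (esym (cat_take_drop (size u) w)) e _); last first.
  by rewrite size_takel.
apply: bI WI _ _ (esym (cat_take_drop (size u) w)) _.
by rewrite size_takel.
Qed.

Lemma above_climb w S : climb w S -> above S w.
Proof.
elim=> {w S} [w _|w w' S ww' _ IH I]; first exact: above_path.
case=> [/above_path//|SI] u v e s.
have sw : (size u <= size w')%N by rewrite -(up_size ww') e size_cat leq_addr.
have e' := esym (cat_take_drop (size u) w').
apply: leq_trans (slope_up ww' e e' _) _; first by rewrite size_takel.
by apply: IH SI _ _ e' _; rewrite size_takel.
Qed.

(** * Independence of the maximal chain *)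

Section Braid.
Variable Inv : set (mindex n) -> Prop.
(** The six listed vertices bound the hexagon swept by a braid move. Keeping the two inner vertices
    out of [X] makes the move a genuine exchange, so that a label can be redefined without touching
    [X]. *)
Hypothesis Inv_flip : forall (X : set (mindex n)) u i j k,
  (i < j)%N -> (j < k)%N -> Pi a (vtx (u ++ [:: i; j; k])) ->
  (forall t, t \in [:: [::]; [:: i]; [:: i; j]; [:: i; j; k]; [:: k; j]; [:: k]] ->
     X (vtx (u ++ t))) ->
  ~ X (vtx (u ++ [:: j])) -> ~ X (vtx (u ++ [:: i; k])) ->
  Inv (X `|` [set vtx (u ++ [:: j])]) <-> Inv (X `|` [set vtx (u ++ [:: i; k])]).

Definition word w := forall i, count_mem i w = a i.

Lemma up_word w w' : up w w' -> word w -> word w'.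
Proof. by move=> ww' hw i; rewrite -(up_count i ww'). Qed.

(** Diamond argument: two different first steps are continued to a common word [w3], and the tails
    are compared by induction on [asc]. The set [W] carries the vertices already swept, so that
    [Inv] always speaks of the whole vertex set. *)
Lemma climb_inv w S S' W : word w -> climb w S -> climb w S' -> below W w ->
  Inv (W `|` S) <-> Inv (W `|` S').
Proof.
have [m] := ubnP (asc w); elim: m w S S' W => // m IHm w S S' W hm hw cS cS' bW.
have [[-> nup]|[w1 [S1 [up1 c1 ->]]]] := climbP cS;
  have [[-> nup']|[w2 [S2 [up2 c2 ->]]]] := climbP cS' => //.
- by have := nup _ up2.
- by have := nup' _ up1.
rewrite !setUA {cS cS' S S'}.
have key w' S' : up w w' -> climb w' S' -> forall S0, climb w' S0 ->
   Inv (W `|` path_vert w `|` S') <-> Inv (W `|` path_vert w `|` S0).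
  move=> ww' cS' S0 cS0; apply: (IHm w').
  - by move: (asc_up ww') hm; lia.
  - exact: up_word hw.
  - exact: cS'.
  - exact: cS0.
  - exact: below_up.
have {hm} goal2 u i j v u' i' j' v' : (i < j)%N -> (i' < j')%N ->
    w = u ++ i :: j :: v -> w = u' ++ i' :: j' :: v' -> (size u <= size u')%N ->
    forall S1 S2, climb (u ++ j :: i :: v) S1 -> climb (u' ++ j' :: i' :: v') S2 ->
    Inv (W `|` path_vert w `|` S1) <-> Inv (W `|` path_vert w `|` S2).
  move=> ij ij' e e' le {}S1 {}S2 {}c1 {}c2.
  have {}up1 : up w (u ++ j :: i :: v) by rewrite e; apply: Up.
  have {}up2 : up w (u' ++ j' :: i' :: v') by rewrite e'; apply: Up.
  have [m0 [eu em]] := cat_prefix le (etrans (esym e) e').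
  (* The distance between the two swaps decides: zero is the same swap, one is a braid move, two or
     more is a commutation. *)
  case: m0 eu em => [|x [|y m0]] eu em.
  - case: em => ei ej ev; rewrite cats0 in eu; subst u' i' j' v'.
    exact: key c1 _ c2.
  - case: em => ex ei ev; subst x i' v u'; rename j' into k, ij' into jk.
    rewrite -!catA /= in up2 c2 e'.
    pose w3 := u ++ [:: k, j, i & v'].
    have [S3 c3] := climb_ex w3.
    have c1' : climb (u ++ [:: j, i, k & v'])
        (path_vert (u ++ [:: j, i, k & v']) `|` (path_vert (u ++ [:: j, k, i & v']) `|` S3)).
      apply: climb_step (climb_step _ c3); last exact: Up.
      rewrite -[u ++ [:: j, i, k & v']]/(u ++ [:: j] ++ [:: i, k & v']).
      rewrite -[u ++ [:: j, k, i & v']]/(u ++ [:: j] ++ [:: k, i & v']) !catA.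
      by apply: Up; apply: ltn_trans jk.
    have c2' : climb (u ++ [:: i, k, j & v'])
        (path_vert (u ++ [:: i, k, j & v']) `|` (path_vert (u ++ [:: k, i, j & v']) `|` S3)).
      apply: climb_step (climb_step _ c3); first by apply: Up; apply: ltn_trans jk.
      rewrite -[u ++ [:: k, i, j & v']]/(u ++ [:: k] ++ [:: i, j & v']).
      by rewrite /w3 -[u ++ [:: k, j, i & v']]/(u ++ [:: k] ++ [:: j, i & v']) !catA; apply: Up.
    apply: (iff_trans (key _ _ up1 c1 _ c1')).
    apply: iff_sym; apply: (iff_trans (key _ _ up2 c2 _ c2')); apply: iff_sym.
    pose X := W `|` path_vert w `|` S3.
    have c3X : path_vert w3 `<=` X by move=> I /(climb_path c3); right.
    have cwX : path_vert w `<=` X by move=> I wI; left; right.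
    have -> : W `|` path_vert w `|` (path_vert (u ++ [:: j, i, k & v'])
        `|` (path_vert (u ++ [:: j, k, i & v']) `|` S3)) = X `|` [set vtx (u ++ [:: j])].
      apply/seteqP; split=> I.
      + case=> [WI|[]]; first by left; left.
          by move/path_vert_swap; rewrite -e => -[/cwX XI|->]; [by left | by right].
        case=> [|SI]; last by left; right.
        rewrite -[u ++ [:: j, k, i & v']]/(u ++ [:: j] ++ [:: k, i & v']) catA.
        move/path_vert_swap => -[|->].
          rewrite -catA /=; move/path_vert_swap; rewrite -e => -[/cwX XI|->]; [by left | by right].
        left; apply: c3X; rewrite -catA /=.
        have -> : vtx (u ++ [:: j; k]) = vtx (u ++ [:: k; j]).
          by apply: eq_vtx => h; rewrite !count_cat; count_lia.
        by exists (u ++ [:: k; j]), (i :: v'); rewrite -catA.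
      + case=> [[WI|SI]|->]; [by left | by right; right; right |].
        by right; left; exists (u ++ [:: j]), [:: i, k & v']; rewrite -catA.
    have -> : W `|` path_vert w `|` (path_vert (u ++ [:: i, k, j & v'])
        `|` (path_vert (u ++ [:: k, i, j & v']) `|` S3)) = X `|` [set vtx (u ++ [:: i; k])].
      have sw1 : path_vert (u ++ [:: i, k, j & v']) `<=` X `|` [set vtx (u ++ [:: i; k])].
        move=> I; rewrite -[u ++ [:: i, k, j & v']]/(u ++ [:: i] ++ [:: k, j & v']) catA.
        move/path_vert_swap; rewrite -catA /= -e => -[/cwX XI|->]; [by left | by right; rewrite -catA].
      apply/seteqP; split=> I.
      + case=> [WI|[]]; [by left; left | exact: sw1 |].
        case=> [|SI]; last by left; right.
        move/path_vert_swap => -[/sw1//|->]; left; apply: c3X.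
        by exists (u ++ [:: k]), [:: j, i & v']; rewrite -catA.
      + case=> [[WI|SI]|->]; [by left | by right; right; right |].
        by right; left; exists (u ++ [:: i; k]), (j :: v'); rewrite -catA.
    have bX : below (W `|` path_vert w) w by move=> I [/bW//|/below_path].
    apply: Inv_flip => //.
    + move=> h; rewrite vtxE -hw e -[u ++ [:: i, j, k & v']]/(u ++ [:: i; j; k] ++ v') catA.
      by rewrite [X in (_ <= X)%N]count_cat leq_addr.
    + move=> t; rewrite !inE; do ?case/orP; move=> /eqP ->.
      * by apply: cwX; rewrite cats0 e; apply: path_vert_cat.
      * by apply: cwX; rewrite e; exists (u ++ [:: i]), [:: j, k & v']; rewrite -catA.
      * by apply: cwX; rewrite e; exists (u ++ [:: i; j]), [:: k & v']; rewrite -catA.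
      * by apply: cwX; rewrite e; exists (u ++ [:: i; j; k]), v'; rewrite -catA.
      * by apply: c3X; exists (u ++ [:: k; j]), [:: i & v']; rewrite -catA.
      * by apply: c3X; exists (u ++ [:: k]), [:: j, i & v']; rewrite -catA.
    (* Slopes are squeezed: membership would give [u ++ [:: j]] at most the slope of [u ++ [:: i]],
       or at least that of [u ++ [:: k]], against [i < j < k]. The next case compares [i k] with
       [i j] and [k j] in the same way. *)
    + case=> [/bX|/(above_climb c3)].
      * move=> /(_ (u ++ [:: i]) [:: j, k & v']); rewrite weight_vtx !slope_vtx !size_cat -catA.
        by move=> /(_ e erefl); rewrite !map_cat !sumn_cat /=; lia.
      * move=> /(_ (u ++ [:: k]) [:: j, i & v']); rewrite weight_vtx !slope_vtx !size_cat -catA.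
        by move=> /(_ erefl erefl); rewrite !map_cat !sumn_cat /=; lia.
    + case=> [/bX|/(above_climb c3)].
      * move=> /(_ (u ++ [:: i; j]) [:: k & v']); rewrite weight_vtx !slope_vtx !size_cat -catA.
        by move=> /(_ e erefl); rewrite !map_cat !sumn_cat /=; lia.
      * move=> /(_ (u ++ [:: k; j]) [:: i & v']); rewrite weight_vtx !slope_vtx !size_cat -catA.
        by move=> /(_ erefl erefl); rewrite !map_cat !sumn_cat /=; lia.
  - case: em => ex ey ev; subst x y v u'.
    rewrite -!catA /= in up2 c2 e'.
    pose w3 := u ++ [:: j, i & m0 ++ [:: j', i' & v']].
    have [S3 c3] := climb_ex w3.
    have c1' := @climb_step (u ++ [:: j, i & m0 ++ [:: i', j' & v']]) w3 S3 _ c3.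
    have c2' := @climb_step (u ++ [:: i, j & m0 ++ [:: j', i' & v']]) w3 S3 _ c3.
    have up13 : up (u ++ [:: j, i & m0 ++ [:: i', j' & v']]) w3.
      rewrite /w3 -[_ ++ [:: j, i & m0 ++ [:: i', j' & v']]]/(u ++ [:: j, i & m0] ++ [:: i', j' & v']).
      by rewrite -[_ ++ [:: j, i & m0 ++ [:: j', i' & v']]]/(u ++ [:: j, i & m0] ++ [:: j', i' & v']) !catA; apply: Up.
    have up23 : up (u ++ [:: i, j & m0 ++ [:: j', i' & v']]) w3 by apply: Up.
    apply: (iff_trans (key _ _ up1 c1 _ (c1' up13))).
    apply: iff_sym; apply: (iff_trans (key _ _ up2 c2 _ (c2' up23))).
    suff -> : W `|` path_vert w `|` (path_vert (u ++ [:: i, j & m0 ++ [:: j', i' & v']]) `|` S3) =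
      W `|` path_vert w `|` (path_vert (u ++ [:: j, i & m0 ++ [:: i', j' & v']]) `|` S3) by [].
    have c3X : path_vert w3 `<=` S3 by apply: climb_path.
    apply/seteqP; split=> I [WI|[|SI]]; try by left.
    + rewrite -[_ ++ [:: i, j & m0 ++ [:: j', i' & v']]]/(u ++ [:: i, j & m0] ++ [:: j', i' & v']) catA.
      move/path_vert_swap; rewrite -catA /= -e => -[wI|->]; first by left; right.
      right; right; apply: c3X; rewrite -catA /=.
      have -> : vtx (u ++ [:: i, j & m0 ++ [:: j']]) = vtx (u ++ [:: j, i & m0 ++ [:: j']]).
        by apply: eq_vtx => h; rewrite !count_cat; count_lia.
      by exists (u ++ [:: j, i & m0 ++ [:: j']]), (i' :: v'); rewrite /w3 -catA /= -catA.
    + by right; right.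
    + move/path_vert_swap; rewrite -e => -[wI|->]; first by left; right.
      right; right; apply: c3X.
      by exists (u ++ [:: j]), [:: i & m0 ++ [:: j', i' & v']]; rewrite /w3 -catA.
    + by right; right.
have [u [i [j [v [ij e e1]]]]] := upP up1.
have [u' [i' [j' [v' [ij' e' e2]]]]] := upP up2.
rewrite e1 in c1; rewrite e2 in c2.
have [le|lt] := leqP (size u) (size u').
  exact: (goal2 u i j v u' i' j' v').
by apply: iff_sym; apply: (goal2 u' i' j' v' u i j v) => //; apply: ltnW.
Qed.
End Braid.
End Words.

(** * Flips *)

Section Climbs.
Variables (n : nat) (a : 'I_n -> nat).
Implicit Types (I : mindex n) (i j k : 'I_n) (u v w : seq 'I_n) (S W : set (mindex n)).

Definition ord_le : rel 'I_n := fun i j => (i <= j)%N.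
Definition ord_ge : rel 'I_n := fun i j => (j <= i)%N.

Lemma ord_le_trans : transitive ord_le.
Proof. by move=> j i k; apply: leq_trans. Qed.

Lemma ord_ge_trans : transitive ord_ge.
Proof. by move=> j i k ij jk; apply: leq_trans jk ij. Qed.

Lemma sorted_cat_rel (r : rel 'I_n) u v i j :
  transitive r -> sorted r (u ++ v) -> i \in u -> j \in v -> r i j.
Proof.
move=> tr; rewrite sorted_pairwise // pairwise_cat => /and3P[/allrelP h _ _].
exact: h.
Qed.

Lemma vtx_surj I : exists u, vtx u = I.
Proof.
have [m] := ubnP (weight I); elim: m I => // m IHm I; rewrite ltnS => hm.
have [/forallP h|] := boolP [forall i, I i == 0%N].
  by exists [::]; apply/ffunP => i; rewrite vtxE (eqP (h i)).
rewrite negb_forall => /existsP[i]; rewrite -lt0n => Ii.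
have [|u eu] := IHm (sub_seq I [:: i]).
  by move: hm; rewrite -{1}(sub_seq1K Ii) weight_add addn1.
by exists (u ++ [:: i]); rewrite /vtx -add_seqA -/(vtx u) eu sub_seq1K.
Qed.

Lemma sorted_word : exists2 w, word a w & sorted ord_le w.
Proof.
have [u eu] := vtx_surj [ffun i => a i].
exists (sort ord_le u).
  move=> i; have /permP -> : perm_eq (sort ord_le u) u by rewrite perm_sort.
  by rewrite -vtxE eu ffunE.
by apply: sort_sorted => i j; apply: leq_total.
Qed.

Lemma sorted_word_uniq w w' :
  word a w -> word a w' -> sorted ord_le w -> sorted ord_le w' -> w = w'.
Proof.
move=> hw hw' s s'; apply: (sorted_eq ord_le_trans) s s' _.
  by move=> i j /anti_leq/val_inj.
by apply/allP => i _ /=; rewrite hw hw'.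
Qed.

Lemma first_ascent w : sorted ord_ge w \/
  exists u i j v, [/\ w = u ++ i :: j :: v, (i < j)%N & sorted ord_ge (rcons u i)].
Proof.
elim: w => [|x w IHw]; first by left.
case: w IHw => [|y w] IHw; first by left.
have [lt|le] := ltnP x y; first by right; exists [::], x, y, w.
case: IHw => [s|[u [i [j [v [e ij s]]]]]].
  by left; rewrite /= in s *; rewrite s andbT.
right; exists (x :: u), i, j, v; rewrite e; split=> //=.
by case: u e s => [|z u] [<- _] /=; rewrite ?andbT // => ->; rewrite andbT.
Qed.

Lemma descent w : sorted ord_le w \/
  exists u i j v, w = u ++ j :: i :: v /\ (i < j)%N.
Proof.
elim: w => [|x w IHw]; first by left.
case: w IHw => [|y w] IHw; first by left.
have [lt|le] := ltnP y x; first by right; exists [::], y, x, w.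
case: IHw => [s|[u [i [j [v [e ij]]]]]].
  by left; rewrite /= in s *; rewrite s andbT.
by right; exists (x :: u), i, j, v; rewrite e.
Qed.

(** Undoing a descent prepends an [up] step; repeating this leads back to the increasing word, so
    every maximal chain is the tail of one that starts there. *)
Lemma climb_through w0 w S : word a w0 -> sorted ord_le w0 -> word a w ->
  climb w S -> exists2 S', climb w0 S' & S `<=` S'.
Proof.
move=> hw0 s0; have [m] := ubnP (desc w).
elim: m w S => // m IHm w S hm hw cS.
case: (descent w) => [s|[u [i [j [v [e ij]]]]]].
  by exists S => //; rewrite (sorted_word_uniq hw0 hw).
have uw : up (u ++ i :: j :: v) w by rewrite e; apply: Up.
have [||S' cS' sub] := IHm _ _ _ _ (climb_step uw cS).
- by move: (desc_up uw) hm; lia.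
- by move=> k; rewrite (up_count k uw).
by exists S' => // I SI; apply: sub; right.
Qed.

(** Source of uniqueness: a word for [I] followed by a word for its complement is a path through
    [I], and chains reach every path. *)
Lemma climb_to_vertex w0 I : word a w0 -> sorted ord_le w0 -> Pi a I ->
  exists2 S, climb w0 S & S I.
Proof.
move=> hw0 s0 PI; have [u eu] := vtx_surj I.
have [v ev] := vtx_surj [ffun i => (a i - I i)%N].
have hw : word a (u ++ v).
  by move=> i; rewrite count_cat -!vtxE eu ev ffunE subnKC.
have [S cS] := climb_ex (u ++ v).
have [S' cS' sub] := climb_through hw0 s0 hw cS.
by exists S' => //; apply/sub/(climb_path cS); rewrite -eu; apply: path_vert_cat.
Qed.

(* Swapping the first ascent [i j] after [u] cannot create a gap at [i], since
   [u] has no letter below [i]. *)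
Lemma interval_climb w0 : word a w0 -> sorted ord_le w0 ->
  exists2 S, climb w0 S & S `<=` interval_pt a.
Proof.
move=> hw0 s0.
pose Q w := word a w /\ path_vert w `<=` interval_pt a.
have [||S cS hS] := @climb_build n Q _ w0.
- move=> w [hw iw] [w' /upP[u0 [i0 [j0 [v0 [ij0 e0 _]]]]]].
  case: (first_ascent w) => [s|[u [i [j [v [e ij s]]]]]].
    have : ord_ge i0 j0.
      apply: (@sorted_cat_rel _ (u0 ++ [:: i0]) (j0 :: v0)) ord_ge_trans _ _ _.
      + by rewrite -catA -e0.
      + by rewrite mem_cat mem_head orbT.
      + exact: mem_head.
    by rewrite /ord_ge leqNgt ij0.
  have uw : up w (u ++ j :: i :: v) by rewrite e; apply: Up.
  exists (u ++ j :: i :: v) => //; split; first exact: up_word uw hw.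
  move=> I /path_vert_swap; rewrite -e => -[/iw//|->] p q r pq qr.
  have iI : interval_pt a (vtx (u ++ [:: i; j])).
    by apply: iw; exists (u ++ [:: i; j]), v; rewrite -catA.
  have := iI p q r pq qr; rewrite !vtxE !count_cat => iI' hp hr.
  have {}iI' := iI' _ _.
  have [eq|ne] := eqVneq i q; last first.
    apply: leq_trans (iI' _ _) _.
    + by apply: leq_trans hp _; count_lia.
    + by apply: leq_trans hr _; count_lia.
    + by rewrite /= (negbTE ne).
  move: hp; rewrite addn_gt0 -!has_count.
  case/orP => /hasP[x xp /eqP ex]; subst.
    have := @sorted_cat_rel _ u [:: q] p q ord_ge_trans; rewrite cats1 => /(_ s xp (mem_head _ _)).
    by rewrite /ord_ge leqNgt pq.
  by move: xp; rewrite inE => /eqP xp; move: pq ij; rewrite -xp; lia.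
- split=> // I [u [v [e ->]]] p q r pq qr; rewrite !vtxE => _ hr.
  rewrite leqNgt; apply/negP => hq.
  have qv : q \in v.
    rewrite -has_pred1 has_count; move: (hw0 q); rewrite e count_cat; lia.
  have ru : r \in u by rewrite -has_pred1 has_count.
  have := sorted_cat_rel ord_le_trans _ ru qv; rewrite -e => /(_ s0).
  by rewrite /ord_le leqNgt qr.
by exists S => // I /hS[w [_ iw] /iw].
Qed.

(** * Transport of labels across a flip *)

Section Flip.
Variables (F : realFieldType).

(** Positivity on all of [Pi a] is demanded because the uniqueness argument cancels labels of this
    solution at vertices outside [V]. *)
Definition extendable (V : set (mindex n)) :=
  forall x : mindex n -> F, (forall I, V I -> 0 < x I) ->
  exists y : mindex n -> F, [/\ forall I, Pi a I -> 0 < y I, cube_recurrence a y &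
    forall I, V I -> y I = x I].

Lemma extendable_sub V V' : V' `<=` V -> extendable V -> extendable V'.
Proof.
move=> sub eV x xp.
have [|y [yp yc ye]] := eV (fun I => if `[< V' I >] then x I else 1).
  by move=> I _; case: asboolP => [/xp//|_]; apply: ltr01.
exists y; split=> // I VI; rewrite ye; last exact: sub.
by case: asboolP.
Qed.

Section Exchange.
Variables (X : set (mindex n)) (p q : mindex n) (s : (mindex n -> F) -> F).
Hypothesis Pp : Pi a p.
Hypothesis s_eq : forall y, cube_recurrence a y -> y p * y q = s y.
Hypothesis s_ext : forall y z, (forall I, X I -> y I = z I) -> s y = s z.
Hypothesis s_gt0 : forall y, (forall I, X I -> 0 < y I) -> 0 < s y.

(** The equation forces the label [s x / x q] at [p]; as [p] is not in [X], installing it leaves the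
    labels on [X] and the value of [s] unchanged. *)
Lemma extendable_exchange : ~ X p ->
  extendable (X `|` [set p]) -> extendable (X `|` [set q]).
Proof.
move=> nXp eX x xp; pose x' I := if I == p then s x / x q else x I.
have sx : 0 < s x by apply: s_gt0 => I XI; apply: xp; left.
have xq : 0 < x q by apply: xp; right.
have xx' I : X I -> x' I = x I by rewrite /x'; case: eqP => // ->.
have [|y [yp yc ye]] := eX x'.
  move=> I [XI|->]; first by rewrite xx' //; apply: xp; left.
  by rewrite /x' eqxx divr_gt0.
exists y; split=> // I [XI|->]; first by rewrite ye ?xx' //; left.
have ey : s y = s x by apply: s_ext => I' XI; rewrite ye ?xx' //; left.
have := s_eq yc; rewrite ye; last by right.
rewrite /x' eqxx ey => e.
have nz : s x / x q != 0 by rewrite mulf_neq0 ?invr_neq0 ?lt0r_neq0.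
apply: (mulfI nz); rewrite e mulfVK //; exact: lt0r_neq0.
Qed.

(** The only factor cancelled is [y p], so no sign condition on [z] enters. *)
Lemma agree_exchange (y z : mindex n -> F) :
  (forall I, Pi a I -> 0 < y I) -> cube_recurrence a y -> cube_recurrence a z ->
  (forall I, (X `|` [set p]) I -> z I = y I) ->
  (forall I, (X `|` [set q]) I -> z I = y I).
Proof.
move=> yp yc zc h I [XI|->]; first by apply: h; left.
have ep : z p = y p by apply: h; right.
have es : s z = s y by apply: s_ext => I' XI; apply: h; left.
apply: (mulfI (lt0r_neq0 (yp p Pp))).
by rewrite -{1}ep (s_eq zc) (s_eq yc).
Qed.
End Exchange.

Definition cube_sum u i j k (y : mindex n -> F) : F :=
  y (vtx (u ++ [::])) * y (vtx (u ++ [:: i; j; k])) +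
  y (vtx (u ++ [:: i; j])) * y (vtx (u ++ [:: k])) +
  y (vtx (u ++ [:: k; j])) * y (vtx (u ++ [:: i])).

Lemma cube_sum_eq u i j k y : (i < j)%N -> (j < k)%N ->
  Pi a (vtx (u ++ [:: i; j; k])) -> cube_recurrence a y ->
  y (vtx (u ++ [:: j])) * y (vtx (u ++ [:: i; k])) = cube_sum u i j k y.
Proof.
move=> ij jk PI /cube_recurrenceP /(_ (vtx u) i j k ij jk).
rewrite /cube_eq /vtx !add_seqA -/(vtx _) => /(_ PI).
rewrite mulrC => ->; rewrite /cube_sum cats0.
by have -> : vtx (u ++ [:: k; j]) = vtx (u ++ [:: j; k])
  by apply: eq_vtx => h; rewrite !count_cat; count_lia.
Qed.

Definition hexagon i j k : seq (seq 'I_n) :=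
  [:: [::]; [:: i]; [:: i; j]; [:: i; j; k]; [:: k; j]; [:: k]].

Lemma cube_sum_ext X u i j k :
  (forall t, t \in hexagon i j k -> X (vtx (u ++ t))) ->
  forall y z, (forall I, X I -> y I = z I) -> cube_sum u i j k y = cube_sum u i j k z.
Proof. by move=> hX y z yz; rewrite /cube_sum !yz //; apply: hX; rewrite !inE eqxx ?orbT. Qed.

Lemma cube_sum_gt0 X u i j k :
  (forall t, t \in hexagon i j k -> X (vtx (u ++ t))) ->
  forall y, (forall I, X I -> 0 < y I) -> 0 < cube_sum u i j k y.
Proof.
move=> hX y yp.
by rewrite /cube_sum !addr_gt0 // mulr_gt0 // yp //; apply: hX; rewrite !inE eqxx ?orbT.
Qed.

Lemma extendable_climb w S S' : word a w -> climb w S -> climb w S' ->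
  extendable S -> extendable S'.
Proof.
move=> hw cS cS'.
have := @climb_inv n a extendable _ w S S' set0 hw cS cS'.
rewrite !set0U => h; apply h; last by move=> I [].
move=> X u i j k ij jk PI hX nj nik.
have e1 y := @cube_sum_eq u i j k y ij jk PI.
have e2 y : cube_recurrence a y ->
    y (vtx (u ++ [:: i; k])) * y (vtx (u ++ [:: j])) = cube_sum u i j k y.
  by rewrite mulrC; apply: e1.
have ex := cube_sum_ext hX; have po := cube_sum_gt0 hX.
by split; apply: (extendable_exchange _ ex po).
Qed.

Lemma agree_climb w S S' (y z : mindex n -> F) :
  word a w -> climb w S -> climb w S' ->
  (forall I, Pi a I -> 0 < y I) -> cube_recurrence a y -> cube_recurrence a z ->
  (forall I, S I -> z I = y I) -> (forall I, S' I -> z I = y I).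
Proof.
move=> hw cS cS' yp yc zc.
have := @climb_inv n a (fun V => forall I, V I -> z I = y I) _ w S S' set0 hw cS cS'.
rewrite !set0U => h; apply h; last by move=> I [].
move=> X u i j k ij jk PI hX nj nik.
have e1 y' := @cube_sum_eq u i j k y' ij jk PI.
have e2 y' : cube_recurrence a y' ->
    y' (vtx (u ++ [:: i; k])) * y' (vtx (u ++ [:: j])) = cube_sum u i j k y'.
  by rewrite mulrC; apply: e1.
have ex := cube_sum_ext hX.
have P1 : Pi a (vtx (u ++ [:: j])).
  by apply: Pi_le PI => h'; rewrite !vtxE !count_cat leq_add2l; count_lia.
have P2 : Pi a (vtx (u ++ [:: i; k])).
  by apply: Pi_le PI => h'; rewrite !vtxE !count_cat leq_add2l; count_lia.
by split; apply: (agree_exchange _ _ ex).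
Qed.

Lemma climb_extendable w S : word a w -> sorted ord_le w -> climb w S -> extendable S.
Proof.
move=> hw sw cS; have [S0 c0 s0] := interval_climb hw sw.
apply: (extendable_climb hw c0 cS); apply: extendable_sub s0 _ => x xp.
exact: interval_extension.
Qed.

End Flip.
End Climbs.

(** * Tilings *)

Section Tiling.
Variables (R : realType) (n : nat) (a : 'I_n -> nat) (theta : 'I_n -> R).
Variable (T : set (cell n)).
Hypothesis tilingT : is_tiling a theta T.
Implicit Types (c : cell n) (f h : 'I_n -> R).

Definition plane_x f : R := \sum_i f i * cos (theta i).
Definition plane_y f : R := \sum_i f i * sin (theta i).

Definition in_cell c f :=
  forall i, (c.1 i)%:R <= f i <= (c.1 i)%:R + (i \in c.2)%:R.

Definition in_box f := forall i, 0 <= f i <= (a i)%:R.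

Lemma plane_projE (x : 'rV[R]_n) :
  plane_proj theta x = (plane_x (x ord0), plane_y (x ord0)).
Proof.
rewrite /plane_proj /plane_x /plane_y; elim/big_ind3 : _ => //.
by move=> p1 p2 _ q1 q2 _ -> ->.
Qed.

Lemma in_cell_body c f : in_cell c f -> cell_body R c (\row_i f i).
Proof. by move=> h i /=; rewrite mxE /shift_by ffunE natrD. Qed.

Lemma cell_body_in c (x : 'rV[R]_n) : cell_body R c x -> in_cell c (x ord0).
Proof. by move=> h i; have := h i; rewrite /= /shift_by ffunE natrD. Qed.

Lemma in_box_body f : in_box f -> box R a (\row_i f i).
Proof. by move=> h i /=; rewrite mxE. Qed.

Lemma lin_row f : plane_x ((\row_i f i) ord0) = plane_x f /\ plane_y ((\row_i f i) ord0) = plane_y f.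
Proof. by split; apply: eq_bigr => i _; rewrite mxE. Qed.

Lemma tiling_inj c c' f f' : T c -> T c' -> in_cell c f -> in_cell c' f' ->
  plane_x f = plane_x f' -> plane_y f = plane_y f' -> f =1 f'.
Proof.
move=> Tc Tc' cf cf' ex ey.
have [_ _ [g [gf _ _ _]]] := tilingT.
have b x d : T d -> in_cell d x -> body R T (\row_i x i).
  by move=> Td dx; exists d => //; apply: in_cell_body.
have [_ e1] := gf _ (b _ _ Tc cf); have [_ e2] := gf _ (b _ _ Tc' cf').
have e : \row_i f i = \row_i f' i.
  rewrite -e1 -e2 !plane_projE !(proj1 (lin_row _)) !(proj2 (lin_row _)).
  by rewrite ex ey.
by move=> i; have /rowP/(_ i) := e; rewrite !mxE.
Qed.

Lemma tiling_surj f : in_box f ->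
  exists c h, [/\ T c, in_cell c h, plane_x h = plane_x f & plane_y h = plane_y f].
Proof.
move=> bf; have [_ _ [g [_ gz _ _]]] := tilingT.
have zf : zonotope a theta (plane_proj theta (\row_i f i)).
  by exists (\row_i f i) => //; apply: in_box_body.
have [[c Tc cg] e] := gz _ zf.
exists c, (g (plane_proj theta (\row_i f i)) ord0); split=> //.
- exact: cell_body_in.
- by move: e; rewrite !plane_projE => -[+ _]; rewrite (proj1 (lin_row _)).
- by move: e; rewrite !plane_projE => -[_]; rewrite (proj2 (lin_row _)).
Qed.

(** Continuity of the inverse at the image of [f]: a short move along [e] stays in the zonotope and
    its preimage stays near [f]. When [f] is the midpoint of an edge, radius 1/4 keeps the
    half-integral coordinate away from the integers. *)
Lemma tiling_near c f (e : 'I_n -> R) : T c -> in_cell c f ->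
  (forall t, 0 <= t <= 1 -> in_box (fun i => f i + t * e i)) ->
  exists (t : R) c' h, [/\ 0 < t, T c', in_cell c' h &
    [/\ plane_x h = plane_x f + t * plane_x e, plane_y h = plane_y f + t * plane_y e &
    forall i, `|h i - f i| < 4^-1]].
Proof.
move=> Tc cf bf; have [_ _ [g [gf gz _ gc]]] := tilingT.
pose y t := plane_proj theta (\row_i (f i + t * e i)).
have yE t : y t = (plane_x f + t * plane_x e, plane_y f + t * plane_y e).
  rewrite /y plane_projE (proj1 (lin_row _)) (proj2 (lin_row _)).
  rewrite /plane_x /plane_y !mulr_sumr -!big_split /=.
  by congr pair; apply: eq_bigr => i _; rewrite mulrDl mulrA.
have zy t : 0 <= t <= 1 -> zonotope a theta (y t).
  by move=> /bf ht; exists (\row_i (f i + t * e i)) => //; apply: in_box_body.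
have bT : body R T (\row_i f i) by exists c => //; apply: in_cell_body.
have y0 : y 0 = plane_proj theta (\row_i f i).
  by congr plane_proj; apply/rowP => i; rewrite !mxE mul0r addr0.
have gy0 : g (y 0) = \row_i f i by rewrite y0 (proj2 (gf _ bT)).
have z0 : zonotope a theta (y 0) by apply: zy; rewrite lexx ler01.
have gcy : g @ within (zonotope a theta) (nbhs (y 0)) --> \row_i f i.
  by rewrite -gy0; apply: ((subspace_continuousP _ _).1 gc (y 0) z0).
move: gcy => /(_ (ball (\row_i f i) 4^-1)).
have b4 : nbhs (\row_i f i) (ball (\row_i f i) (4^-1 : R)).
  by apply: nbhsx_ballx; rewrite invr_gt0.
move=> /(_ b4); rewrite /= => /nbhs_ballP[eps /= eps0 sub].
(* [t * M] bounds both coordinates of the displacement; the summand 1 makes [M] positive and the 2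
   in [t] makes the bound by [eps] strict. *)
pose M := 1 + `|plane_x e| + `|plane_y e|.
have M0 : 0 < M by rewrite /M; have := normr_ge0 (plane_x e); have := normr_ge0 (plane_y e); lra.
pose t := Num.min 1 (eps / (2 * M)).
have t0 : 0 < t by rewrite /t lt_min ltr01 /= divr_gt0 // mulr_gt0.
have t1 : t <= 1 by rewrite /t ge_min lexx.
have tM : t * M < eps.
  have : t <= eps / (2 * M) by rewrite /t ge_min lexx orbT.
  rewrite -(ler_pM2r M0) => /le_lt_trans; apply.
  have -> : eps / (2 * M) * M = eps / 2 by field; rewrite lt0r_neq0.
  lra.
have zt : zonotope a theta (y t) by apply: zy; rewrite ltW.
have bt : ball (y 0) eps (y t).
  rewrite !yE !mul0r !addr0.
  split; rewrite /ball /= opprD addrA subrr sub0r normrN normrM gtr0_norm //;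
    apply: le_lt_trans tM; rewrite ler_pM2l // /M;
    have := normr_ge0 (plane_x e); have := normr_ge0 (plane_y e); lra.
have [[c' Tc' cg] ey] := gz _ zt.
exists t, c', (g (y t) ord0); split=> //; first exact: cell_body_in.
move: ey; rewrite plane_projE yE => -[ex ey]; split=> // i.
have [_ /(_ ord0 i)] := sub _ bt zt.
by rewrite mxE /ball /= distrC yE.
Qed.
End Tiling.

(** * Sweeping a path across a tiling *)

Section TilingPaths.
Variables (R : realType) (n : nat) (a : 'I_n -> nat) (theta : 'I_n -> R).
Hypothesis htheta : forall i, 0 < theta i < pi.
Hypothesis hmono : forall i j : 'I_n, (i < j)%N -> theta i < theta j.
Variable (T : set (cell n)).
Hypothesis tilingT : is_tiling a theta T.
Implicit Types (c : cell n) (f h : 'I_n -> R) (i j d : 'I_n) (I J K : mindex n).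

Local Notation C i := (cos (theta i)).
Local Notation Sn i := (sin (theta i)).
Local Notation linx := (plane_x theta).
Local Notation liny := (plane_y theta).

(** The determinant of the two directions, that is, the sine of [theta j - theta i]. *)
Definition wedge i j : R := C i * Sn j - Sn i * C j.
Local Notation D := wedge.

Lemma sin_theta_gt0 i : 0 < Sn i.
Proof. exact: sin_gt0_pi. Qed.

Lemma wedge_gt0 i j : (i < j)%N -> 0 < D i j.
Proof.
move=> /hmono ij; rewrite /wedge.
have -> : C i * Sn j - Sn i * C j = sin (theta j - theta i) by rewrite sinB; ring.
have /andP[i0 _] := htheta i; have /andP[_ jp] := htheta j.
by apply: sin_gt0_pi; rewrite subr_gt0 ij /=; lra.
Qed.

Lemma wedgeC i j : D i j = - D j i.
Proof. by rewrite /wedge; ring. Qed.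

Lemma wedge_lt0 i j : (j < i)%N -> D i j < 0.
Proof. by move=> ji; rewrite wedgeC oppr_lt0 wedge_gt0. Qed.

Lemma wedgexx i : D i i = 0.
Proof. by rewrite /wedge; ring. Qed.

(** Determinant with direction [d]: positive exactly for vectors to the left of that direction. *)
Definition cross d (x y : R) : R := C d * y - Sn d * x.

Lemma cross_lin d f : cross d (linx f) (liny f) = \sum_i f i * D d i.
Proof.
rewrite /cross /plane_x /plane_y !mulr_sumr -sumrB; apply: eq_bigr => i _.
by rewrite /wedge; ring.
Qed.

Lemma sum_pt (g f : 'I_n -> R) al d be d' :
  \sum_i (f i + al * (i == d)%:R + be * (i == d')%:R) * g i =
  \sum_i f i * g i + al * g d + be * g d'.
Proof.
have one (x : R) k : \sum_i x * (i == k)%:R * g i = x * g k.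
  rewrite (bigD1 k) //= eqxx mulr1 big1 ?addr0 // => i /negbTE ->.
  by rewrite mulr0 mul0r.
under eq_bigr do rewrite !mulrDl.
by rewrite !big_split /= !one.
Qed.

Definition natf (I : mindex n) : 'I_n -> R := fun i => (I i)%:R.

Lemma natf_add I s (g : 'I_n -> R) :
  \sum_i natf (add_seq I s) i * g i = \sum_i natf I i * g i + \sum_(d <- s) g d.
Proof.
elim: s I => [|d s IHs] I; first by rewrite big_nil addr0 add_seq0.
rewrite -[d :: s]cat1s -add_seqA IHs big_cat /= big_seq1 addrA; congr (_ + _).
rewrite -[X in _ + X]mul1r -[RHS]addr0 -[X in _ + X](mul0r (g d)) -sum_pt.
by apply: eq_bigr => i _; rewrite /natf add_seqE /= addn0 natrD eq_sym; congr (_ * _); ring.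
Qed.

Lemma tiling_le J (S : {set 'I_n}) i : T (J, S) -> (J i + (i \in S) <= a i)%N.
Proof.
have [[sub _] _ _] := tilingT.
by move=> /sub /(_ S (fintype.subxx S)) /(_ i); rewrite ffunE.
Qed.

Lemma tiling_face J (S U V : {set 'I_n}) :
  T (J, S) -> U \subset S -> V \subset S :\: U -> T (shift_by J U, V).
Proof.
have [[_ fc] _ _] := tilingT => TJ US VS.
by apply: fc TJ _; exists U.
Qed.

(** A cell this close to the midpoint of an edge contains the edge: coordinate [d] of [h] lies
    strictly between consecutive integers, and each other coordinate is too close to that of [J] for
    the cell to miss it. *)
Lemma near_edge c h J d : in_cell c h ->
  (forall i, `|h i - ((J i)%:R + 2^-1 * (i == d)%:R)| < 4^-1) ->
  [/\ d \in c.2, c.1 d = J d & forall i, (c.1 i <= J i <= c.1 i + (i \in c.2))%N].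
Proof.
move=> ch near.
have le i : (c.1 i <= J i <= c.1 i + (i \in c.2))%N.
  have /andP[h1 h2] := ch i; have := near i.
  rewrite ltr_distlC => /andP[n1 n2].
  have b0 : 0 <= 2^-1 * (i == d)%:R :> R by rewrite mulr_ge0 ?ler0n ?invr_ge0.
  have b1 : 2^-1 * (i == d)%:R <= 2^-1 :> R.
    by rewrite ler_piMr ?invr_ge0 ?lern1 ?leq_b1.
  apply/andP; split.
  - rewrite -ltnS -(ltr_nat R) -natr1; lra.
  - rewrite -ltnS -(ltr_nat R) -natr1 natrD; lra.
have dS : d \in c.2.
  have /andP[h1 h2] := ch d; have := near d; rewrite eqxx mulr1 ltr_distlC => /andP[n1 n2].
  apply/negPn/negP => nd; rewrite (negbTE nd) addr0 in h2.
  have /andP[le1 _] := le d; move: le1; rewrite -(ler_nat R); lra.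
split=> //.
have /andP[h1 h2] := ch d; have := near d; rewrite eqxx mulr1 ltr_distlC => /andP[n1 n2].
have /andP[le1 _] := le d; apply/eqP; rewrite eqn_leq le1 /=.
rewrite -ltnS -(ltr_nat R) -natr1; move: h2; rewrite dS /=; lra.
Qed.

(** Larger indices point further left, so a tile to the left of the edge has it either as its lower
    right edge ([left_low]) or as its upper right edge ([left_up]). *)
Definition left_low J d := exists2 d' : 'I_n, (d < d')%N & T (J, [set d; d']%SET).
Definition left_up J d := exists2 d' : 'I_n, (d' < d)%N &
  (0 < J d')%N /\ T (sub_seq J [:: d'], [set d; d']%SET).

(** The midpoint of the edge is pushed slightly along [sg] times direction [e], which points left
    and stays in the box. The cell reached contains the edge together with one further direction. *)
Lemma left_tile_dir J d (e : 'I_n) (sg : R) : T (J, [set d]%SET) ->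
  (sg = 1 /\ (d < e)%N /\ (J e < a e)%N) \/ (sg = -1 /\ (e < d)%N /\ (0 < J e)%N) ->
  left_low J d \/ left_up J d.
Proof.
move=> TJ dir.
have ned : e != d by case: dir => -[_ []]; [move=> + _; apply: contraTneq => ->; rewrite ltnn ..].
have [Je0 Jd0] : (J e <= a e)%N /\ (J d < a d)%N.
  have := tiling_le e TJ; have := tiling_le d TJ.
  by rewrite !inE eqxx (negbTE ned) addn1 addn0.
pose f i : R := (J i)%:R + 2^-1 * (i == d)%:R.
pose ev i : R := sg * (i == e)%:R.
have cf : in_cell (J, [set d]%SET) f.
  move=> i; rewrite /f /= inE; case: (i == d) => /=; lra.
have [|t [[K S] [h [t0 TK ch [ex ey near]]]]] := tiling_near tilingT (e := ev) TJ cf.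
  move=> t t01 i; rewrite /f /ev.
  have Ji : 0 <= (J i)%:R :> R by [].
  have Jai : (J i)%:R <= (a i)%:R :> R.
    by rewrite ler_nat; apply: leq_trans (tiling_le i TJ); rewrite leq_addr.
  case: (eqVneq i d) => [->|nid] /=.
    rewrite [d == e]eq_sym (negbTE ned) /=.
    have : (J d)%:R + 1 <= (a d)%:R :> R by rewrite natr1 ler_nat.
    have : 0 <= (J d)%:R :> R by [].
    lra.
  case: (eqVneq i e) => [->|nie] /=; last by lra.
  have J0 : 0 <= (J e)%:R :> R by [].
  have Ja : (J e)%:R <= (a e)%:R :> R by rewrite ler_nat.
  case: dir => -[-> [_ lt]].
    have : (J e)%:R + 1 <= (a e)%:R :> R by rewrite natr1 ler_nat.
    nra.
  have : 1 <= (J e)%:R :> R by rewrite ler1n.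
  nra.
have [/= dS Kd Kle] := near_edge ch near.
have crossE : \sum_i (h i - f i) * D d i = t * (sg * D d e).
  have -> : \sum_i (h i - f i) * D d i = cross d (linx h) (liny h) - cross d (linx f) (liny f).
    by rewrite !cross_lin -sumrB; apply: eq_bigr => i _; rewrite mulrBl.
  have -> : sg * D d e = cross d (linx ev) (liny ev).
    rewrite cross_lin (bigD1 e) //= big1 ?addr0 => [|i /negbTE ne]; rewrite /ev ?eqxx ?mulr1 //.
    by rewrite ne mulr0 mul0r.
  by rewrite ex ey /cross; ring.
have pos : 0 < t * (sg * D d e).
  rewrite mulr_gt0 //; case: dir => -[-> [de _]]; rewrite ?mul1r ?mulN1r ?oppr_gt0.
    exact: wedge_gt0.
  exact: wedge_lt0.
have [[_ _] [dim2 _] _] := tilingT.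
have S2 : (#|S| <= 2)%N := dim2 _ TK.
have off i : i != d -> i \notin S -> h i = f i.
  move=> nid nS; have := ch i; have := Kle i; rewrite /= (negbTE nS) addn0 addr0 -eqn_leq.
  by move=> /eqP -> /le_anti <-; rewrite /f (negbTE nid) mulr0 addr0.
(* With [d] as the only direction, the displacement would be parallel to the edge and its cross
   product zero. *)
have [d' nd' d'S] : exists2 d', d' != d & d' \in S.
  have [/exists_inP[d' d'S nd']|] := boolP [exists d' in S, d' != d]; first by exists d'.
  rewrite negb_exists_in => /forall_inP no.
  move: pos; rewrite -crossE big1 ?ltxx // => i _.
  have [->|nid] := eqVneq i d; first by rewrite wedgexx mulr0.
  rewrite off ?subrr ?mul0r //; apply/negP => /no; by rewrite nid.
have SE : S = [set d; d']%SET.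
  apply/eqP; rewrite eq_sym eqEcard; apply/andP; split.
    by apply/fintype.subsetP => i; rewrite !inE => /orP[] /eqP ->.
  by rewrite cards2 eq_sym nd'.
have offJ i : i != d' -> K i = J i.
  move=> ni; have [->//|nid] := eqVneq i d.
  have := Kle i; rewrite SE !inE (negbTE nid) (negbTE ni) addn0.
  by rewrite -eqn_leq => /eqP.
have {}pos : 0 < (h d' - (J d')%:R) * D d d'.
  move: pos; rewrite -crossE (bigD1 d') //= big1 ?addr0.
    by rewrite {1}/f (negbTE nd') mulr0 addr0.
  move=> i ni; have [->|nid] := eqVneq i d; first by rewrite wedgexx mulr0.
  by rewrite off ?subrr ?mul0r // SE !inE negb_or nid ni.
have := ch d'; rewrite /= d'S mulr1n => /andP[h1 h2].
have := Kle d'; rewrite d'S addn1 => /andP[k1 k2].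
(* The sign of [D d d'] tells whether coordinate [d'] went up or down, hence whether the base of the
   tile is [J] or lies one unit below it. *)
have [lt|gt|/val_inj e'] := ltngtP d d'; last by rewrite e' eqxx in nd'.
  left; exists d' => //.
  have -> : J = K; last by rewrite -SE.
  apply/ffunP => i; have [->|/offJ//] := eqVneq i d'.
  apply/eqP; rewrite eqn_leq k1 andbT -ltnS -(ltr_nat R) -natr1.
  by move: pos; rewrite pmulr_lgt0 ?wedge_gt0 //; lra.
right; exists d' => //.
have K1 : (K d' < J d')%N.
  by rewrite -(ltr_nat R); move: pos; rewrite nmulr_lgt0 ?wedge_lt0 //; lra.
split; first by apply: leq_ltn_trans K1.
have -> : sub_seq J [:: d'] = K; last by rewrite -SE.
apply/ffunP => i; rewrite ffunE /= addn0; have [->|ni] := eqVneq i d'.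
  by rewrite /=; lia.
by rewrite subn0 offJ.
Qed.

Definition left_bdry J d :=
  (forall i, (d < i)%N -> J i = a i) /\ (forall i, (i < d)%N -> J i = 0%N).

Lemma left_tile J d : T (J, [set d]%SET) -> ~ left_bdry J d ->
  left_low J d \/ left_up J d.
Proof.
move=> TJ nb.
have [[i [di Ji]]|no1] := pselect (exists i, (d < i)%N /\ (J i < a i)%N).
  by apply: (@left_tile_dir _ _ i 1) => //; left.
have [[i [di Ji]]|no2] := pselect (exists i, (i < d)%N /\ (0 < J i)%N).
  by apply: (@left_tile_dir _ _ i (-1)) => //; right.
case: nb; split=> i di.
- apply/eqP; rewrite eqn_leq (leq_trans _ (tiling_le i TJ)) ?leq_addr //=.
  by rewrite leqNgt; apply/negP => h; apply: no1; exists i.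
- by apply/eqP; rewrite -leqn0 leqNgt; apply/negP => h; apply: no2; exists i.
Qed.

Lemma ray_combination i j k :
  D i k * C j = D j k * C i + D i j * C k /\ D i k * Sn j = D j k * Sn i + D i j * Sn k.
Proof. by rewrite /wedge; split; ring. Qed.

(* The cones spanned by [v_d', v_f'] and by [v_d, v_f] have interior points in
   common; every coefficient comes from a relation among two or three of the
   four vectors. *)
Lemma cones_meet (d d' f f' : 'I_n) : (d < d')%N -> (f' < f)%N ->
  exists al be ga de : R,
    [/\ 0 < al <= 1, 0 < be <= 1, 0 < ga <= 1 & 0 < de <= 1] /\
    (be * C d' + de * C f' = ga * C f + al * C d /\
     be * Sn d' + de * Sn f' = ga * Sn f + al * Sn d).
Proof.
move=> dd' ff'.
pose sol al be ga de := be * C d' + de * C f' = ga * C f + al * C d /\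
     be * Sn d' + de * Sn f' = ga * Sn f + al * Sn d.
have [al1 [be1 [ga1 [de1 [[p1 p2 p3 p4] s1]]]]] : exists al be ga de : R,
    [/\ 0 <= al, 0 < be, 0 < ga & 0 <= de] /\ sol al be ga de.
  rewrite /sol; have [lt|gt|/val_inj <-] := ltngtP d' f.
  - exists (D d' f), (D d f), (D d d'), 0; split.
      by have := ltn_trans dd' lt => df; split; rewrite ?lexx // ?ltW ?wedge_gt0.
    by have [-> ->] := ray_combination d d' f; split; ring.
  - exists 0, (D f' f), (D f' d'), (D f d'); split.
      by have := ltn_trans ff' gt => fd; split; rewrite ?lexx // ?ltW ?wedge_gt0.
    by have [-> ->] := ray_combination f' f d'; split; ring.
  - by exists 0, 1, 1, 0; split; [split; rewrite ?ltr01 ?lexx | split; ring].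
have [al2 [be2 [ga2 [de2 [[q1 q2 q3 q4] s2]]]]] : exists al be ga de : R,
    [/\ 0 < al, 0 <= be, 0 <= ga & 0 < de] /\ sol al be ga de.
  rewrite /sol; have [lt|gt|/val_inj <-] := ltngtP d f'.
  - exists (D f' f), 0, (D d f'), (D d f); split.
      by have := ltn_trans lt ff' => df; split; rewrite ?lexx // ?ltW ?wedge_gt0.
    by have [-> ->] := ray_combination d f' f; split; ring.
  - exists (D f' d'), (D f' d), 0, (D d d'); split.
      by have := ltn_trans gt dd' => fd; split; rewrite ?lexx // ?ltW ?wedge_gt0.
    by have [-> ->] := ray_combination f' d d'; split; ring.
  - by exists 1, 0, 0, 1; split; [split; rewrite ?ltr01 ?lexx | split; ring].
(* Each partial solution may have two vanishing coefficients, but never the same ones; their sum is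
   positive throughout, and division by the total makes all coefficients at most 1. *)
pose M := al1 + al2 + be1 + be2 + ga1 + ga2 + de1 + de2.
have M0 : 0 < M by rewrite /M; lra.
exists ((al1 + al2) / M), ((be1 + be2) / M), ((ga1 + ga2) / M), ((de1 + de2) / M).
split.
  by split; apply/andP; split; rewrite ?divr_gt0 ?ler_pdivrMr ?mul1r //; rewrite ?/M; lra.
have [e1 e2] := s1; have [e3 e4] := s2.
split; apply: (mulIf (lt0r_neq0 M0)).
- have -> : ((be1 + be2) / M * C d' + (de1 + de2) / M * C f') * M =
    (be1 * C d' + de1 * C f') + (be2 * C d' + de2 * C f') by field; rewrite lt0r_neq0.
  by rewrite e1 e3; field; rewrite lt0r_neq0.
- have -> : ((be1 + be2) / M * Sn d' + (de1 + de2) / M * Sn f') * M =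
    (be1 * Sn d' + de1 * Sn f') + (be2 * Sn d' + de2 * Sn f') by field; rewrite lt0r_neq0.
  by rewrite e2 e4; field; rewrite lt0r_neq0.
Qed.

Lemma in_cell_pt J (d d' : 'I_n) (al be : R) : d != d' ->
  0 <= al <= 1 -> 0 <= be <= 1 ->
  in_cell (J, [set d; d']%SET)
    (fun i => natf J i + al * (i == d)%:R + be * (i == d')%:R).
Proof.
move=> ne al01 be01 i; rewrite /natf /= !inE.
case: (eqVneq i d) => [->|_] /=; last by case: (i == d') => /=; lra.
by rewrite (negbTE ne) /=; lra.
Qed.

(** At the common vertex the first tile spans the cone of [-v_d] and [v_d'], the second that of
    [v_f] and [-v_f']. By [cones_meet] they share an interior point, so injectivity of the
    projection makes them the same tile. *)
Lemma left_tiles_eq J K (d d' f f' : 'I_n) : (d < d')%N -> (f' < f)%N ->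
  T (J, [set d; d']%SET) -> T (K, [set f; f']%SET) ->
  add_seq J [:: d] = add_seq K [:: f'] -> d = f' /\ d' = f.
Proof.
move=> dd' ff' TJ TK eJK.
have [al [be [ga [de [[b1 b2 b3 b4] [ex ey]]]]]] := cones_meet dd' ff'.
have nd : d != d' by apply: contraTneq dd' => ->; rewrite ltnn.
have nf : f != f' by apply: contraTneq ff' => ->; rewrite ltnn.
have c1 : in_cell (J, [set d; d']%SET)
    (fun i => natf J i + (1 - al) * (i == d)%:R + be * (i == d')%:R).
  by apply: in_cell_pt => //; lra.
have c2 : in_cell (K, [set f; f']%SET)
    (fun i => natf K i + ga * (i == f)%:R + (1 - de) * (i == f')%:R).
  by apply: in_cell_pt => //; lra.
have e0 (g : 'I_n -> R) : \sum_i natf J i * g i + g d = \sum_i natf K i * g i + g f'.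
  by have := natf_add J [:: d] g; rewrite eJK natf_add !big_seq1.
have e : forall i, natf J i + (1 - al) * (i == d)%:R + be * (i == d')%:R =
    natf K i + ga * (i == f)%:R + (1 - de) * (i == f')%:R.
  apply: (tiling_inj tilingT TJ TK c1 c2); rewrite /plane_x /plane_y !sum_pt.
  - by have := e0 (fun i => C i); lra.
  - by have := e0 (fun i => Sn i); lra.
have {}e i : be * (i == d')%:R + de * (i == f')%:R = ga * (i == f)%:R + al * (i == d)%:R.
  have := e i; have := congr1 (fun I : mindex n => (I i)%:R : R) eJK.
  rewrite /natf !add_seqE /= !addn0 !natrD ![_ == i]eq_sym; lra.
split.
- apply/eqP/negPn/negP => ne; have := e d; rewrite eqxx (negbTE nd) (negbTE ne).
  by case: (d == f) => /=; lra.
- apply/eqP/negPn/negP => ne; have := e d'; rewrite eqxx (negbTE ne) [d' == d]eq_sym (negbTE nd).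
  by case: (d' == f') => /=; lra.
Qed.

Definition tiling_path w := forall u d v, w = u ++ d :: v -> T (vtx u, [set d]%SET).

Lemma vtx_rcons u d : vtx (rcons u d) = add_seq (vtx u) [:: d].
Proof. by rewrite /vtx add_seqA cats1. Qed.

Lemma vtx_lt w u d v (k : 'I_n) : word a w -> w = u ++ d :: v -> k \in d :: v ->
  (vtx u k < a k)%N.
Proof.
move=> hw e kv; rewrite vtxE -hw e count_cat -[X in (X < _)%N]addn0 ltn_add2l.
by rewrite -has_count has_pred1.
Qed.

(** Going up the path from an edge whose left tile is low, the next edge is either low as well or
    the upper right edge of the same tile, which gives the swap. Neither the end of the path nor a
    left boundary edge can come first, since coordinate [d'] still has room. *)
Lemma swap_after_low w u d v : word a w -> tiling_path w -> w = u ++ d :: v ->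
  left_low (vtx u) d ->
  exists u d d' v, [/\ w = u ++ d :: d' :: v, (d < d')%N &
    T (vtx u, [set d; d']%SET)].
Proof.
move=> hw pw; elim: v u d => [|e v IHv] u d ew [d' dd' Td'].
  have := tiling_le d' Td'; rewrite !inE eqxx orbT addn1 vtxE -(hw d') ew count_cat /= addn0.
  have -> : (d == d') = false by apply/negbTE; apply: contraTneq dd' => ->; rewrite ltnn.
  by rewrite addn0 ltnn.
have ew' : w = rcons u d ++ e :: v by rewrite cat_rcons.
have [lb|nlb] := pselect (left_bdry (vtx (rcons u d)) e).
  have [lb1 lb2] := lb.
  have ed : (e <= d)%N.
    rewrite leqNgt; apply/negP => /lb2; rewrite vtx_rcons add_seqE /= eqxx; lia.
  have := lb1 d' (leq_ltn_trans ed dd'); rewrite vtx_rcons add_seqE /=.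
  have -> : (d == d') = false by apply/negbTE; apply: contraTneq dd' => ->; rewrite ltnn.
  by have := tiling_le d' Td'; rewrite !inE eqxx orbT; lia.
have [low|[f ef [Jf Tf]]] := left_tile (pw _ _ _ ew') nlb; first exact: IHv ew' low.
have [|ed d'e] := left_tiles_eq dd' ef Td' Tf; first by rewrite sub_seq1K // vtx_rcons.
by exists u, d, e, v; split=> //; rewrite -d'e.
Qed.

Lemma tiling_swap w : word a w -> tiling_path w -> (exists w', up w w') ->
  exists u d d' v, [/\ w = u ++ d :: d' :: v, (d < d')%N &
    T (vtx u, [set d; d']%SET)].
Proof.
move=> hw pw [_ /upP[u0 [i [j [v0 [ij e0 _]]]]]].
have claim t : forall m, w = m ++ t ->
    (forall p e s, m = p ++ e :: s -> left_bdry (vtx p) e) ->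
    (exists u d v, t = u ++ d :: v /\ ~ left_bdry (vtx (m ++ u)) d) ->
    exists u d d' v, [/\ w = u ++ d :: d' :: v, (d < d')%N &
      T (vtx u, [set d; d']%SET)].
  elim: t => [|x t IHt] m em lbm [u [d [v [et nlb]]]]; first by case: u et nlb.
  have [lbx|nlbx] := pselect (left_bdry (vtx m) x).
    apply: (IHt (rcons m x)).
    - by rewrite cat_rcons.
    - move=> p e s; case/lastP: s => [|s y] eq; last first.
        by move: eq; rewrite -rcons_cons -rcons_cat => /rcons_inj[/lbm].
      by move: eq; rewrite cats1 => /rcons_inj[<- <-].
    - case: u et nlb => [|y u] [ey et] nlb; first by case: nlb; rewrite cats0 -ey.
      by exists u, d, v; split=> //; rewrite cat_rcons ey.
  have [low|[d' d'x [md' _]]] := left_tile (pw _ _ _ em) nlbx.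
    exact: swap_after_low em low.
  exfalso; move: md'; case/lastP: m em lbm {nlb nlbx} => [|m e] em lbm; first by rewrite vtxE.
  have [lb1 lb2] : left_bdry (vtx m) e by apply: (lbm _ _ [::]); rewrite cats1.
  rewrite cat_rcons in em.
  have xe : (x <= e)%N.
    rewrite leqNgt; apply/negP => /lb1 ex.
    have := vtx_lt (k := x) hw em; rewrite ex ltnn !inE eqxx orbT.
    by move=> /(_ isT).
  have de := leq_trans d'x xe.
  rewrite vtx_rcons add_seqE lb2 //=.
  by have -> : (e == d') = false by apply/negbTE; apply: contraTneq de => ->; rewrite ltnn.
apply: (claim w [::]) => //; first by case.
exists u0, i, (j :: v0); split=> //= -[lb _].
have := vtx_lt (k := j) hw e0; rewrite lb // ltnn !inE eqxx orbT.
by move=> /(_ isT).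
Qed.

Lemma shift_by0 J : shift_by J finset.set0 = J.
Proof. by apply/ffunP => i; rewrite ffunE inE addn0. Qed.

Lemma shift_by1 J d : shift_by J [set d]%SET = add_seq J [:: d].
Proof. by apply: shift_by_seq => // i; rewrite !inE. Qed.

Lemma tile_edges J d d' : d != d' -> T (J, [set d; d']%SET) ->
  T (J, [set d']%SET) /\ T (add_seq J [:: d'], [set d]%SET).
Proof.
move=> ne TJ; split.
- rewrite -[J]shift_by0; apply: tiling_face TJ (finset.sub0set _) _.
  by apply/fintype.subsetP => i; rewrite !inE => ->; rewrite orbT.
- rewrite -shift_by1; apply: tiling_face TJ _ _.
    by apply/fintype.subsetP => i; rewrite !inE => ->; rewrite orbT.
  by apply/fintype.subsetP => i; rewrite !inE => /eqP ->; rewrite ne eqxx.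
Qed.

Lemma tiling_path_swap u d d' v : (d < d')%N -> T (vtx u, [set d; d']%SET) ->
  tiling_path (u ++ d :: d' :: v) -> tiling_path (u ++ d' :: d :: v).
Proof.
move=> dd' Tu pw p e s ep.
have ne : d != d' by apply: contraTneq dd' => ->; rewrite ltnn.
have [T1 T2] := tile_edges ne Tu.
have [lt|le] := ltnP (size p) (size u).
  have [[|x m] [eu em]] := cat_prefix (ltnW lt) (esym ep).
    by rewrite eu cats0 ltnn in lt.
  by apply: (pw p e (m ++ d :: d' :: v)); rewrite eu -catA; case: em => ->.
have [m [-> em]] := cat_prefix le ep.
case: m em => [|x [|y m]] /=.
- by case=> <- _; rewrite cats0.
- by case=> <- <- _; rewrite cats1 vtx_rcons.
- case=> <- <- em; have -> : vtx (u ++ [:: d', d & m]) = vtx (u ++ [:: d, d' & m]).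
    by apply: eq_vtx => k; rewrite !count_cat; count_lia.
  by apply: (pw _ e s); rewrite -catA em.
Qed.

Lemma tiling_path_vert w : w != [::] -> tiling_path w -> path_vert w `<=` vert T.
Proof.
move=> nw pw I [u [v [e ->]]]; case/lastP: u e => [|u d] e.
  case: w nw pw e => // d w _ pw e.
  rewrite /vert /= -[vtx [::]]shift_by0.
  apply: (@tiling_face _ [set d]%SET) (finset.sub0set _) (finset.sub0set _).
  exact: (pw [::] d w).
rewrite /vert /= vtx_rcons -shift_by1.
apply: (@tiling_face _ [set d]%SET) (finset.sub0set _) => //.
by apply: (pw u d v); rewrite e cat_rcons.
Qed.

Lemma sorted_bdry w u d v : word a w -> sorted (@ord_le n) w -> w = u ++ d :: v ->
  (forall i, (i < d)%N -> vtx u i = a i) /\ (forall i, (d < i)%N -> vtx u i = 0%N).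
Proof.
move=> hw sw e; split=> i di; rewrite vtxE; last first.
  apply/count_memPn/negP => iu; rewrite e in sw.
  have := sorted_cat_rel (@ord_le_trans n) sw iu (mem_head d v).
  by rewrite /ord_le leqNgt di.
rewrite -(hw i) e count_cat.
suff -> : count_mem i (d :: v) = 0%N by rewrite addn0.
apply/count_memPn; rewrite inE negb_or; apply/andP; split.
  by apply: contraTneq di => ->; rewrite ltnn.
apply/negP => iv; rewrite e -cat_rcons in sw.
have du : d \in rcons u d by rewrite mem_rcons mem_head.
have := sorted_cat_rel (@ord_le_trans n) sw du iv.
by rewrite /ord_le leqNgt di.
Qed.

Lemma no_up_bdry w u d v : word a w -> (forall w', ~ up w w') -> w = u ++ d :: v ->
  left_bdry (vtx u) d.
Proof.
move=> hw nup e.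
have sw : sorted (@ord_ge n) w.
  case: (first_ascent w) => // -[u' [i [j [v' [e' ij _]]]]].
  by case: (nup (u' ++ j :: i :: v')); rewrite e'; apply: Up.
split=> i di; rewrite vtxE; last first.
  apply/count_memPn/negP => iu; rewrite e in sw.
  have := sorted_cat_rel (@ord_ge_trans n) sw iu (mem_head d v).
  by rewrite /ord_ge leqNgt di.
rewrite -(hw i) e count_cat.
suff -> : count_mem i (d :: v) = 0%N by rewrite addn0.
apply/count_memPn; rewrite inE negb_or; apply/andP; split.
  by apply: contraTneq di => ->; rewrite ltnn.
apply/negP => iv; rewrite e -cat_rcons in sw.
have du : d \in rcons u d by rewrite mem_rcons mem_head.
have := sorted_cat_rel (@ord_ge_trans n) sw du iv.
by rewrite /ord_ge leqNgt di.
Qed.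

(* Points of a right boundary edge have only one preimage in the box. *)
Lemma right_bdry_edge J d : (forall i, (i < d)%N -> J i = a i) ->
  (forall i, (d < i)%N -> J i = 0%N) -> (J d < a d)%N -> T (J, [set d]%SET).
Proof.
move=> lo hi Jd; pose f i : R := (J i)%:R + 2^-1 * (i == d)%:R.
have Jda : (J d)%:R + 1 <= (a d)%:R :> R by rewrite natr1 ler_nat.
have J0 i : 0 <= (J i)%:R :> R by [].
have bf : in_box a f.
  move=> i; rewrite /f; have [->|] := eqVneq i d; first by have := J0 d => /=; lra.
  rewrite neq_ltn mulr0 addr0 J0 /= ler_nat => /orP[/lo ->//|/hi ->//].
have [[K S] [h [TK ch ex ey]]] := tiling_surj tilingT bf.
have hbox i : 0 <= h i <= (a i)%:R.
  have /andP[/= h1 h2] := ch i; rewrite (le_trans _ h1) //= (le_trans h2) //.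
  by rewrite -natrD ler_nat tiling_le.
have crossE : \sum_i (h i - f i) * D d i = 0.
  have -> : \sum_i (h i - f i) * D d i = cross d (linx h) (liny h) - cross d (linx f) (liny f).
    by rewrite !cross_lin -sumrB; apply: eq_bigr => i _; rewrite mulrBl.
  by rewrite ex ey subrr.
(* Off [d], the coordinates of [f] are full where [D d i] is negative and zero where it is positive,
   so [f] minimises this form on the box. *)
have term i : 0 <= (h i - f i) * D d i.
  have /andP[h1 h2] := hbox i; case: (ltngtP i d) => [lt|gt|/val_inj ->].
  - rewrite mulr_le0 //; last exact/ltW/wedge_lt0.
    rewrite /f lo //.
    by have -> : (i == d) = false by [apply/negbTE; rewrite neq_ltn lt]; rewrite mulr0 addr0; lra.
  - rewrite mulr_ge0 //; last exact/ltW/wedge_gt0.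
    rewrite /f hi //.
    by have -> : (i == d) = false by [apply/negbTE; rewrite neq_ltn gt orbT]; rewrite mulr0 addr0; lra.
  - by rewrite wedgexx mulr0.
have hf i : i != d -> h i = f i.
  move=> nid; have /psumr_eq0P := crossE => /(_ (fun i _ => term i) i isT)/eqP.
  rewrite mulf_eq0 subr_eq0 => /orP[/eqP//|].
  by move: nid; rewrite neq_ltn => /orP[/wedge_lt0|/wedge_gt0] lt /eqP e; rewrite e ltxx in lt.
(* Direction [d] is invisible to [cross d]; the height recovers its coefficient because the sine is
   positive. *)
have hd : h d = f d.
  have : \sum_i (h i - f i) * Sn i = 0.
    rewrite -[RHS](subrr (liny h)) {2}ey /plane_y -sumrB.
    by apply: eq_bigr => i _; rewrite mulrBl.
  rewrite (bigD1 d) //= big1 ?addr0 => [/eqP|i /hf ->]; last by rewrite subrr mul0r.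
  by rewrite mulf_eq0 (gt_eqF (sin_theta_gt0 d)) orbF subr_eq0 => /eqP.
have [|/= dS Kd Kle] := near_edge ch (J := J) (d := d).
  move=> i; have -> : h i = f i by have [->|/hf] := eqVneq i d.
  by rewrite subrr normr0 invr_gt0.
have -> : J = shift_by K [set i | J i != K i]%SET.
  apply/ffunP => i; rewrite ffunE inE; have := Kle i.
  by case: eqP => [->|ne] /=; [rewrite addn0 | case: (i \in S); lia].
apply: tiling_face TK _ _; apply/fintype.subsetP => i; rewrite !inE.
- by have := Kle i; case: (i \in S) => //; rewrite addn0 -eqn_leq eq_sym => ->.
- by move=> /eqP ->; rewrite Kd eqxx dS.
Qed.

Lemma sorted_tiling_path w : word a w -> sorted (@ord_le n) w -> tiling_path w.
Proof.
move=> hw sw u d v e; have [lo hi] := sorted_bdry hw sw e.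
by apply: right_bdry_edge => //; apply: vtx_lt hw e (mem_head _ _).
Qed.

(** * Position of a point relative to a path *)

Local Notation sumx u := (\sum_(d <- u) C d).
Local Notation sumy u := (\sum_(d <- u) Sn d).

Lemma lin_vtx u : linx (natf (vtx u)) = sumx u /\ liny (natf (vtx u)) = sumy u.
Proof.
by split; rewrite [LHS]natf_add big1 ?add0r // => i _; rewrite /natf ffunE mul0r.
Qed.

(* The sign of [side x y w] tells whether the point [(x, y)] is to the left
   (positive) or to the right of the path [w]. *)
Fixpoint side (x y : R) (w : seq 'I_n) : R :=
  if w is d :: w' then
    if y < Sn d then cross d x y else side (x - C d) (y - Sn d) w'
  else 0.

Lemma side_ge0 w x y :
  (forall u d v, w = u ++ d :: v -> 0 <= cross d (x - sumx u) (y - sumy u)) ->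
  0 <= side x y w.
Proof.
elim: w x y => [|d w IHw] x y h //=; case: ifP => _.
  by have := h [::] d w erefl; rewrite !big_nil !subr0.
apply: IHw => u e v ew; have := h (d :: u) e v; rewrite ew => /(_ erefl).
by rewrite !big_cons !opprD !addrA.
Qed.

Lemma side_le0 w x y :
  (forall u d v, w = u ++ d :: v -> cross d (x - sumx u) (y - sumy u) <= 0) ->
  side x y w <= 0.
Proof.
elim: w x y => [|d w IHw] x y h //=; case: ifP => _.
  by have := h [::] d w erefl; rewrite !big_nil !subr0.
apply: IHw => u e v ew; have := h (d :: u) e v; rewrite ew => /(_ erefl).
by rewrite !big_cons !opprD !addrA.
Qed.

Lemma side_eq0 w x y : 0 <= y -> side x y w = 0 ->
  (exists u d v ga, [/\ w = u ++ d :: v, 0 <= ga <= 1,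
     x = sumx u + ga * C d & y = sumy u + ga * Sn d]) \/ sumy w <= y.
Proof.
elim: w x y => [|d w IHw] x y y0 /=; first by right; rewrite big_nil.
have Sd := sin_theta_gt0 d.
case: ifP => [lt e|/negbT ge e].
  left; exists [::], d, w, (y / Sn d); split=> //.
  - apply/andP; split; first by rewrite divr_ge0 // ltW.
    by rewrite ler_pdivrMr // mul1r ltW.
  - rewrite big_nil add0r; apply: (mulIf (lt0r_neq0 Sd)).
    have -> : y / Sn d * C d * Sn d = C d * y by field; rewrite lt0r_neq0.
    by move: e; rewrite /cross; lra.
  - by rewrite big_nil add0r mulfVK ?lt0r_neq0.
rewrite -leNgt in ge.
have [|[u [d' [v [ga [-> g01 ex ey]]]]]|le] := IHw _ _ _ e; first by lra.
  left; exists (d :: u), d', v, ga; split=> //; rewrite big_cons; lra.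
by right; rewrite big_cons; lra.
Qed.

(** The two paths differ only around one parallelogram, so the sign can change only inside it. The
    witnesses are the coordinates of the point relative to its lowest corner, by Cramer's rule. *)
Lemma side_swap u d d' v x y : (d < d')%N -> 0 <= y ->
  0 <= side x y (u ++ d :: d' :: v) -> side x y (u ++ d' :: d :: v) < 0 ->
  exists al be, [/\ 0 <= al <= 1, 0 <= be <= 1,
    x = sumx u + al * C d + be * C d' & y = sumy u + al * Sn d + be * Sn d'].
Proof.
move=> dd'; elim: u x y => [|e u IHu] x y y0 /=; last first.
  case: ifP => [_ h1 h2|/negbT]; first by move: (le_lt_trans h1 h2); rewrite ltxx.
  rewrite -leNgt => ge h1 h2.
  have [|al [be [b1 b2 ex ey]]] := IHu _ _ _ h1 h2; first by lra.
  by exists al, be; split=> //; rewrite big_cons; lra.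
have D0 := wedge_gt0 dd'; have Sd := sin_theta_gt0 d; have Sd' := sin_theta_gt0 d'.
pose al := - cross d' x y / D d d'; pose be := cross d x y / D d d'.
have ex : x = al * C d + be * C d'.
  by rewrite /al /be /cross /wedge; field; rewrite lt0r_neq0.
have ey : y = al * Sn d + be * Sn d'.
  by rewrite /al /be /cross /wedge; field; rewrite lt0r_neq0.
have cd x' y' : cross d (x - x') (y - y') = be * D d d' - cross d x' y'.
  by rewrite {1}ex {1}ey /cross /wedge; ring.
have cd' x' y' : cross d' (x - x') (y - y') = - al * D d d' - cross d' x' y'.
  by rewrite {1}ex {1}ey /cross /wedge; ring.
have cd0 : cross d x y = be * D d d' by have := cd 0 0; rewrite !subr0 => ->; rewrite /cross; ring.
have cd'0 : cross d' x y = - al * D d d' by have := cd' 0 0; rewrite !subr0 => ->; rewrite /cross; ring.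
have e1 : cross d (C d') (Sn d') = D d d' by rewrite /cross /wedge; ring.
have e2 : cross d' (C d) (Sn d) = - D d d' by rewrite /cross /wedge; ring.
rewrite cd cd' cd0 cd'0 e1 e2.
have be_ge0 : 0 <= be * D d d' -> 0 <= be by rewrite pmulr_lge0.
have al_ge0 : - al * D d d' < 0 -> 0 <= al by rewrite mulNr oppr_lt0 pmulr_lgt0 // => /ltW.
have be_le1 : be * D d d' - D d d' < 0 -> be <= 1.
  by rewrite subr_lt0 gtr_pMl // => /ltW.
have al_le1 : 0 <= - al * D d d' + D d d' -> al <= 1.
  by rewrite mulNr addrC subr_ge0 ger_pMl.
move=> h1 h2; suff [b1 b2] : 0 <= al <= 1 /\ 0 <= be <= 1.
  by exists al, be; rewrite !big_nil !add0r -ex -ey.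
(* The cases record which edge of each path is at the height of the point. The two signs yield two
   of the four bounds and the height the others; above the parallelogram both paths give the same
   value, a contradiction. *)
case: (ltP y (Sn d)) h1 => [yd /be_ge0 b0|yd h1]; case: (ltP y (Sn d')) h2 => [yd'|yd'].
- move=> /al_ge0 a0; split; apply/andP; split=> //; nra.
- have -> : y - Sn d' < Sn d by lra.
  move=> /be_le1 b1; split; apply/andP; split=> //; nra.
- have yd2 : y - Sn d < Sn d' by lra.
  move: h1; rewrite yd2 opprK => /al_le1 a1 /al_ge0 a0.
  split; apply/andP; split=> //; nra.
- move: h1; case: (ltP (y - Sn d) (Sn d')) => [yd2|yd2] h1.
    have -> : y - Sn d' < Sn d by lra.
    move: h1; rewrite opprK => /al_le1 a1 /be_le1 b1.
    split; apply/andP; split=> //; nra.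
  have -> : (y - Sn d' < Sn d) = false by apply/negbTE; rewrite -leNgt; lra.
  have -> : x - C d' - C d = x - C d - C d' by ring.
  have -> : y - Sn d' - Sn d = y - Sn d - Sn d' by ring.
  by move=> h2; move: (le_lt_trans h1 h2); rewrite ltxx.
Qed.

Lemma lin_natf_cross I u d :
  cross d (linx (natf I) - sumx u) (liny (natf I) - sumy u) =
  \sum_i ((I i)%:R - (vtx u i)%:R) * D d i.
Proof.
have [<- <-] := lin_vtx u.
have -> : cross d (linx (natf I) - linx (natf (vtx u))) (liny (natf I) - liny (natf (vtx u))) =
  cross d (linx (natf I)) (liny (natf I)) - cross d (linx (natf (vtx u))) (liny (natf (vtx u))).
  by rewrite /cross; ring.
by rewrite !cross_lin -sumrB; apply: eq_bigr => i _; rewrite mulrBl.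
Qed.

(** A vertex is itself a cell of dimension zero, so injectivity identifies [f] with the vertex. *)
Lemma vert_in_cell J (S : {set 'I_n}) f I : vert T I -> T (J, S) -> in_cell (J, S) f ->
  linx f = linx (natf I) -> liny f = liny (natf I) ->
  forall i, (J i <= I i <= J i + (i \in S))%N.
Proof.
move=> vI TJ cf ex ey i.
have cI : in_cell (I, finset.set0) (natf I).
  by move=> k; rewrite /= inE addr0 lexx.
have e := tiling_inj tilingT TJ vI cf cI ex ey.
by have := cf i; rewrite e /natf /= -natrD !ler_nat.
Qed.

Lemma vert_le I i : vert T I -> (I i <= a i)%N.
Proof. by move=> vI; have := tiling_le i vI; rewrite inE addn0. Qed.

(** A vertex on or left of [w] but right of the swapped path lies in the swapped tile and is
    therefore one of its four corners: three are on [w], the fourth is on the new path. *)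
Lemma tiling_climb w : w != [::] -> word a w -> tiling_path w ->
  exists S, [/\ climb w S, S `<=` vert T & forall I, vert T I ->
    0 <= side (linx (natf I)) (liny (natf I)) w -> S I].
Proof.
have y0 I : 0 <= liny (natf I).
  by apply: sumr_ge0 => i _; rewrite mulr_ge0 ?ler0n // ltW ?sin_theta_gt0.
have [m] := ubnP (asc w); elim: m w => // m IHm w hm nw hw pw.
have [ex|nex] := pselect (exists w', up w w').
  have [u [d [d' [v [e dd' Tu]]]]] := tiling_swap hw pw ex.
  have uw : up w (u ++ d' :: d :: v) by rewrite e; apply: Up.
  have ne : d != d' by apply: contraTneq dd' => ->; rewrite ltnn.
  have [||||S [cS sub cov]] := IHm (u ++ d' :: d :: v).
  - by move: (asc_up uw) hm; lia.
  - by rewrite -size_eq0 size_cat addnS.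
  - exact: up_word uw hw.
  - by apply: tiling_path_swap => //; rewrite -e.
  exists (path_vert w `|` S); split; first exact: climb_step uw cS.
    by move=> I [|/sub//]; apply: tiling_path_vert.
  move=> I vI sI.
  have [ge|lt] := leP 0 (side (linx (natf I)) (liny (natf I)) (u ++ d' :: d :: v)).
    by right; apply: cov.
  rewrite {1}e in sI.
  have [al [be [b1 b2 ex' ey']]] := side_swap dd' (y0 I) sI lt.
  have [lx ly] := lin_vtx u.
  have := vert_in_cell vI Tu (in_cell_pt (vtx u) ne b1 b2).
  rewrite /plane_x /plane_y !sum_pt.
  rewrite -[\sum_i natf (vtx u) i * C i]/(linx _) -[\sum_i natf (vtx u) i * Sn i]/(liny _).
  rewrite lx ly => /(_ (esym ex') (esym ey')) le.
  have Iu t : (forall i, I i = (vtx u i + count_mem i t)%N) -> I = vtx (u ++ t).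
    by move=> h; apply/ffunP => i; rewrite h !vtxE count_cat.
  have le0 i : i != d -> i != d' -> I i = vtx u i.
    by move=> /negbTE n1 /negbTE n2; have := le i; rewrite !inE n1 n2 addn0; lia.
  have led : (vtx u d <= I d <= vtx u d + 1)%N by have := le d; rewrite !inE eqxx.
  have led' : (vtx u d' <= I d' <= vtx u d' + 1)%N by have := le d'; rewrite !inE eqxx orbT.
  have Idd' t : I d = (vtx u d + count_mem d t)%N -> I d' = (vtx u d' + count_mem d' t)%N ->
      {subset t <= [:: d; d']} -> I = vtx (u ++ t).
    move=> h1 h2 st; apply: Iu => i.
    have [->//|n1] := eqVneq i d; have [->//|n2] := eqVneq i d'.
    rewrite le0 //; suff -> : count_mem i t = 0%N by rewrite addn0.
    by apply/count_memPn/negP => /st; rewrite !inE (negbTE n1) (negbTE n2).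
  have ne' : (d' == d) = false by rewrite eq_sym (negbTE ne).
  have [ed|nd] := eqVneq (I d) (vtx u d); have [ed'|nd'] := eqVneq (I d') (vtx u d').
  - left; rewrite (Idd' [::]) ?addn0 // cats0 e; exact: path_vert_cat.
  - right; apply: (climb_path cS); rewrite (Idd' [:: d']).
    + by exists (u ++ [:: d']), (d :: v); rewrite -catA.
    + by rewrite /= ne' !addn0.
    + by rewrite /= eqxx; lia.
    + by move=> i; rewrite !inE => ->; rewrite orbT.
  - left; rewrite (Idd' [:: d]).
    + by exists (u ++ [:: d]), (d' :: v); rewrite -catA.
    + by rewrite /= eqxx; lia.
    + by rewrite /= (negbTE ne) !addn0.
    + by move=> i; rewrite !inE => ->.
  - left; rewrite (Idd' [:: d; d']) //.
    + by exists (u ++ [:: d; d']), v; rewrite -catA.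
    + by rewrite /= eqxx ne'; lia.
    + by rewrite /= eqxx (negbTE ne); lia.
have nup w' : ~ up w w' by move=> uw; apply: nex; exists w'.
exists (path_vert w); split; [exact: climb_end | exact: tiling_path_vert |].
move=> I vI sI.
(* Without ascents [w] is the left boundary of the zonotope, and no vertex is strictly to its
   left. *)
have s0 : side (linx (natf I)) (liny (natf I)) w = 0.
  apply/le_anti; rewrite sI andbT; apply: side_le0 => u d v e.
  have [hi lo] := no_up_bdry hw nup e.
  rewrite lin_natf_cross; apply: sumr_le0 => i _.
  have [lt|gt|/val_inj ->] := ltngtP i d; last by rewrite wedgexx mulr0.
  - by rewrite lo // subr0 mulr_ge0_le0 // ltW // wedge_lt0.
  - rewrite hi // mulr_le0_ge0 //; last exact/ltW/wedge_gt0.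
    by rewrite subr_le0 ler_nat vert_le.
have [[u [d [v [ga [e g01 ex ey]]]]]|top] := side_eq0 (y0 I) s0.
  have Tu := pw _ _ _ e; have [lx ly] := lin_vtx u.
  have cu : in_cell (vtx u, [set d]%SET) (fun i => natf (vtx u) i + ga * (i == d)%:R + 0 * (i == d)%:R).
    by move=> i; rewrite /natf /= !inE; case: (i == d) => /=; lra.
  have := vert_in_cell vI Tu cu; rewrite /plane_x /plane_y !sum_pt !mul0r !addr0.
  rewrite -[\sum_i natf (vtx u) i * C i]/(linx _) -[\sum_i natf (vtx u) i * Sn i]/(liny _).
  rewrite lx ly => /(_ (esym ex) (esym ey)) le.
  have le0 i : i != d -> I i = vtx u i.
    by move=> /negbTE n1; have := le i; rewrite !inE n1 addn0; lia.
  have := le d; rewrite !inE eqxx => led.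
  have [ed|nd] := eqVneq (I d) (vtx u d).
    have -> : I = vtx u by apply/ffunP => i; have [->|/le0] := eqVneq i d.
    by rewrite e; apply: path_vert_cat.
  have -> : I = vtx (rcons u d).
    apply/ffunP => i; rewrite vtx_rcons add_seqE /= addn0.
    by have [->|/le0] := eqVneq i d; [rewrite /=; lia | rewrite addn0].
  by rewrite e -cat_rcons; apply: path_vert_cat.
(* [I] is bounded by [vtx w] in every coordinate and all sines are positive, so reaching the height
   of the top forces equality. *)
have -> : I = vtx w; last by rewrite -[X in path_vert X](cats0 w); apply: path_vert_cat.
have [_ ly] := lin_vtx w.
have Iw i : (I i <= vtx w i)%N by rewrite vtxE hw vert_le.
have term i : 0 <= (natf (vtx w) i - natf I i) * Sn i.
  by rewrite mulr_ge0 ?(ltW (sin_theta_gt0 _)) // subr_ge0 ler_nat.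
have sum0 : \sum_i (natf (vtx w) i - natf I i) * Sn i = 0.
  apply/le_anti; rewrite sumr_ge0 // andbT.
  under eq_bigr do rewrite mulrBl.
  by rewrite sumrB subr_le0 -[X in X <= _]/(liny _) ly.
apply/ffunP => i; have /psumr_eq0P := sum0 => /(_ (fun i _ => term i) i isT)/eqP.
rewrite mulf_eq0 (gt_eqF (sin_theta_gt0 i)) orbF subr_eq0 /natf eqr_nat.
by move=> /eqP.
Qed.

Lemma tiling_climb_sorted w : w != [::] -> word a w -> sorted (@ord_le n) w ->
  exists S, [/\ climb w S, S `<=` vert T & vert T `<=` S].
Proof.
move=> nw hw sw; have [S [cS sub cov]] := tiling_climb nw hw (sorted_tiling_path hw sw).
exists S; split=> // I vI; apply: cov => //; apply: side_ge0 => u d v e.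
have [lo hi] := sorted_bdry hw sw e.
rewrite lin_natf_cross; apply: sumr_ge0 => i _.
have [lt|gt|/val_inj ->] := ltngtP i d; last by rewrite wedgexx mulr0.
- rewrite lo // mulr_le0 //; last exact/ltW/wedge_lt0.
  by rewrite subr_le0 ler_nat vert_le.
- by rewrite hi // subr0 mulr_ge0 // ltW // wedge_gt0.
Qed.
End TilingPaths.

Theorem theorem2p3 (R : realType) (n : nat) (a : 'I_n -> nat)
    (theta : 'I_n -> R) (T : set (cell n)) (F : realFieldType)
    (x : mindex n -> F)
    (hn : (3 <= n)%N)
    (ha : forall i, (0 < a i)%N)
    (htheta : forall i, 0 < theta i < pi)
    (hmono : forall i j : 'I_n, (i < j)%N -> theta i < theta j)
    (hT : is_tiling a theta T)
    (hx : forall I, vert T I -> 0 < x I) :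
  exists2 y : mindex n -> F, is_extension a T x y &
    forall z : mindex n -> F, is_extension a T x z ->
      forall I, Pi a I -> z I = y I.
Proof.
have [w hw sw] := sorted_word a.
have nw : w != [::].
  apply/eqP => w0; have i0 : 'I_n := Ordinal (leq_trans (isT : (0 < 3)%N) hn).
  by have := ha i0; rewrite -hw w0.
have [S [cS ST TS]] := tiling_climb_sorted htheta hmono hT nw hw sw.
have [|y [yp yc ye]] := @climb_extendable n a F w S hw sw cS x.
  by move=> I /ST/hx.
exists y; first by split=> // I /TS/ye.
move=> z [ze zc] I PI; have [S' cS' S'I] := climb_to_vertex hw sw PI.
apply: (agree_climb hw cS cS' yp yc zc _ S'I) => I' SI'.
by rewrite ze ?ye //; apply: ST.
Qed.
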